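(* Let $\mathcal{H}$ be a complex Hilbert space. Let $T=(T_{ij})$ be an $n\times n$ operator matrix, where $T_{ij}\in\mathcal{B}(\mathcal{H})$. Let $f$ and $g$ be non-negative continuous functions on $[0,\infty)$ such that $f(t)g(t)=t$ for all $t\ge0$. Then $$w(T)\le\min_{0\le\alpha\le1}\sqrt{\left\|\alpha|R|^2+(1-\alpha)|S|^2\right\|}\le w(\tilde T),$$ where $R=(r_{ij})_{n\times n}$ with $r_{ij}=\frac12\left(\|f^2(|T_{ij}|)\|^{\frac12}\|g^2(|T_{ij}^*|)\|^{\frac12}+\|f^2(|T_{ji}|)\|^{\frac12}\|g^2(|T_{ji}^*|)\|^{\frac12}\right)$, $S=(s_{ij})_{n\times n}$ with $s_{ij}=\|T_{ij}\|$, and $\tilde T=(\tilde t_{ij})_{n\times n}$ with $\tilde t_{ij}=\|f^2(|T_{ij}|)\|^{\frac12}\|g^2(|T_{ij}^*|)\|^{\frac12}$.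
   Context: $\mathcal{B}(\mathcal{H})$ is the space of bounded linear operators on $\mathcal{H}$, and $\|\cdot\|$ is the usual operator norm. An $n\times n$ operator matrix $T=(T_{ij})$ acts on the Hilbert space direct sum $\oplus_{i=1}^n\mathcal{H}$ by $(Tx)_i=\sum_{j}T_{ij}x_j$. For a bounded operator $T$ on a complex Hilbert space $\mathcal{K}$: the numerical radius is $w(T)=\sup\{|\langle Tx,x\rangle|:x\in\mathcal{K},\ \|x\|=1\}$, and $|T|=(T^*T)^{1/2}$. Expressions $f^2(|T|)=(f(|T|))^2$ and $g^2(|T^*|)=(g(|T^*|))^2$ are understood via the continuous functional calculus. Scalar $n\times n$ matrices (such as $R,S,\tilde T$) are regarded as operators on $\mathbb{C}^n$ with the standard inner product. *)

(* Defs.v *)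
From HB Require Import structures.
From mathcomp Require Import all_boot all_order all_algebra.
From mathcomp Require Import sesquilinear spectral complex.
From mathcomp Require Import all_classical all_reals all_analysis.

Set Implicit Arguments.
Unset Strict Implicit.
Unset Printing Implicit Defensive.

Import Order.TTheory GRing.Theory Num.Theory Num.Def.
Import numFieldNormedType.Exports.

Local Open Scope classical_set_scope.
Local Open Scope ring_scope.
Local Open Scope complex_scope.

(* Inner products are the positive definite hermitian forms of sesquilinear.v:
   linear in the first argument, conjugate-linear in the second one.  A complex
   Hilbert space is a complete normed module over R[i] whose norm is the one
   induced by such a form. *)
Definition is_inner (R : realType) (H : normedModType R[i])
    (d : {dot H for conjC}) : Prop :=
  forall x : H, `|x| ^+ 2 = d x x.

Section Operators.
Variables (R : realType) (V : lmodType R[i]) (d : {dot V for conjC}).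

Definition hnorm (x : V) : R := Num.sqrt (complex.Re (d x x)).

Definition bounded_op (A : V -> V) : Prop :=
  linear A /\ exists M : R, forall x, hnorm (A x) <= M * hnorm x.

(* The suprema below are meant for bounded operators only; [sup] is 0 on the
   empty set, which covers the numerical radius on the trivial space. *)
Definition opnorm (A : V -> V) : R :=
  sup [set hnorm (A x) | x in [set x | hnorm x <= 1]].

Definition numradius (A : V -> V) : R :=
  sup [set complex.Re `|d (A x) x| | x in [set x | hnorm x = 1]].

Definition adjoint (A : V -> V) : V -> V :=
  xget (fun=> 0)
    [set B | bounded_op B /\ forall x y, d (A x) y = d x (B y)].

(* On a complex space, [forall x, 0 <= d (B x) x] also makes B self-adjoint. *)
Definition absop (A : V -> V) : V -> V :=
  xget (fun=> 0)
    [set B | [/\ bounded_op B, forall x, 0 <= d (B x) x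
              & forall x, B (B x) = adjoint A (A x)]].

Definition spectrum (A : V -> V) : set R[i] :=
  [set z | ~ exists B, [/\ bounded_op B, forall x, B (A x - z *: x) = x
                         & forall x, A (B x) - z *: B x = x]].

Definition polyop (A : V -> V) (p : {poly R}) : V -> V :=
  fun x => \sum_(i < size p) (p`_i)%:C *: iter i A x.

(* Continuous functional calculus of a self-adjoint operator A (whose spectrum
   is real) at a function f : R -> R continuous on the spectrum: f(A) is the
   limit in operator norm of p_k(A), for real polynomials p_k converging to f
   uniformly on the spectrum of A. *)
Definition is_cfc (A : V -> V) (f : R -> R) (B : V -> V) : Prop :=
  bounded_op B /\
  exists p : nat -> {poly R},
    (forall e : R, 0 < e -> \forall k \near \oo,
       forall t : R, spectrum A t%:C -> `|(p k).[t] - f t| < e) /\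
    opnorm (fun x => polyop A (p k) x - B x) @[k --> \oo] --> (0 : R).

Definition cfc (A : V -> V) (f : R -> R) : V -> V :=
  xget (fun=> 0) [set B | is_cfc A f B].

End Operators.

Section DirectSum.
Variables (R : realType) (H : lmodType R[i]) (d : {dot H for conjC}) (n : nat).

Definition dsum_dot (x y : {ffun 'I_n -> H}) : R[i] := \sum_i d (x i) (y i).

Let dsum_dot_linl y : linear_for *%R (dsum_dot ^~ y).
Proof.
move=> a u v; rewrite /dsum_dot /= mulr_sumr -big_split /=.
by apply: eq_bigr => i _; rewrite !ffunE linearPl.
Qed.

Let dsum_dot_linr x : linear_for (conjC \; *%R) (dsum_dot x).
Proof.
move=> a u v; rewrite /dsum_dot /= mulr_sumr -big_split /=.
by apply: eq_bigr => i _; rewrite !ffunE linearPr.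
Qed.

HB.instance Definition _ := bilinear_isBilinear.Build
  R[i] {ffun 'I_n -> H} {ffun 'I_n -> H} R[i] *%R (conjC \; *%R) dsum_dot
  (conj dsum_dot_linl dsum_dot_linr).

Let dsum_dot_herm x y : dsum_dot x y = (-1) ^+ false * conjC (dsum_dot y x).
Proof.
rewrite mul1r /dsum_dot rmorph_sum /=.
by apply: eq_bigr => i _; rewrite hermC mul1r.
Qed.

HB.instance Definition _ := isHermitianSesquilinear.Build
  R[i] {ffun 'I_n -> H} false conjC dsum_dot dsum_dot_herm.

Let dsum_dot_gt0 x : x != 0 -> 0 < dsum_dot x x.
Proof.
move=> x0; rewrite lt_def /dsum_dot.
rewrite sumr_ge0 ?andbT; last by move=> i _; exact: dnorm_ge0.
apply: contraNN x0; rewrite psumr_eq0; last by move=> i _; exact: dnorm_ge0.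
move/allP => h; apply/eqP/ffunP => i; rewrite ffunE; apply/eqP.
rewrite -(dnorm_eq0 d); exact: (h i (mem_index_enum i)).
Qed.

HB.instance Definition _ := isDotProduct.Build
  R[i] {ffun 'I_n -> H} dsum_dot dsum_dot_gt0.

Definition opmx (T : 'I_n -> 'I_n -> H -> H) (x : {ffun 'I_n -> H}) :
  {ffun 'I_n -> H} := [ffun i => \sum_j T i j (x j)].

End DirectSum.

Section ScalarMatrices.
Variables (R : realType) (n : nat).

(* The standard inner product on C^n, column vectors; [dotmx] is its library
   version on row vectors. *)
Definition cdot (u v : 'cV[R[i]]_n) : R[i] := dotmx u^T v^T.

Let cdot_linl y : linear_for *%R (cdot ^~ y).
Proof. by move=> a u v; rewrite /cdot linearP /= linearPl. Qed.

Let cdot_linr x : linear_for (conjC \; *%R) (cdot x).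
Proof. by move=> a u v; rewrite /cdot linearP /= linearPr. Qed.

HB.instance Definition _ := bilinear_isBilinear.Build
  R[i] 'cV[R[i]]_n 'cV[R[i]]_n R[i] *%R (conjC \; *%R) cdot
  (conj cdot_linl cdot_linr).

Let cdot_herm x y : cdot x y = (-1) ^+ false * conjC (cdot y x).
Proof. by rewrite mul1r /cdot hermC mul1r. Qed.

HB.instance Definition _ := isHermitianSesquilinear.Build
  R[i] 'cV[R[i]]_n false conjC cdot cdot_herm.

Let cdot_gt0 x : x != 0 -> 0 < cdot x x.
Proof. by move=> x0; rewrite /cdot dnorm_gt0 trmx_eq0. Qed.

HB.instance Definition _ := isDotProduct.Build
  R[i] 'cV[R[i]]_n cdot cdot_gt0.

Definition mxop (A : 'M[R]_n) (x : 'cV[R[i]]_n) : 'cV[R[i]]_n :=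
  map_mx (real_complex R) A *m x.

End ScalarMatrices.

Section NormMatrices.
Variables (R : realType) (H : lmodType R[i]) (d : {dot H for conjC}) (n : nat).
Variables (f g : R -> R) (T : 'I_n -> 'I_n -> H -> H).

(* f^2(A) = (f(A))^2 *)
Definition cfc_sq (A : H -> H) (h : R -> R) : H -> H := cfc d A h \o cfc d A h.

Definition Tmx : 'M[R]_n := \matrix_(i, j)
  (Num.sqrt (opnorm d (cfc_sq (absop d (T i j)) f)) *
   Num.sqrt (opnorm d (cfc_sq (absop d (adjoint d (T i j))) g))).

Definition Rmx : 'M[R]_n := \matrix_(i, j)
  (2^-1 *
   (Num.sqrt (opnorm d (cfc_sq (absop d (T i j)) f)) *
    Num.sqrt (opnorm d (cfc_sq (absop d (adjoint d (T i j))) g)) +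
    Num.sqrt (opnorm d (cfc_sq (absop d (T j i)) f)) *
    Num.sqrt (opnorm d (cfc_sq (absop d (adjoint d (T j i))) g)))).

Definition Smx : 'M[R]_n := \matrix_(i, j) opnorm d (T i j).

End NormMatrices.

Section Bound.
Variables (R : realType) (n : nat).

(* sqrt || a |A|^2 + (1 - a) |B|^2 || *)
Definition mixed_bound (A B : 'M[R]_n) (a : R) : R :=
  let absA := absop (@cdot R n) (mxop A) in
  let absB := absop (@cdot R n) (mxop B) in
  Num.sqrt (opnorm (@cdot R n) (fun x =>
    a%:C *: absA (absA x) + (1 - a)%:C *: absB (absB x))).

End Bound.

Definition is_min (R : realType) (A : set R) (m : R) : Prop :=
  A m /\ lbound A m.

(* Main.v *)
Require Import Defs.
From mathcomp Require Import all_boot all_order all_algebra.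
From mathcomp Require Import sesquilinear spectral complex.
From mathcomp Require Import all_classical all_reals all_analysis.
From mathcomp Require Import ring lra.

(** The theorem is a consequence of one entrywise estimate, namely that
    [|T_ij| <= t_ij] for operator norms, where [t_ij] are the entries of the
    matrix [Tmx].  Indeed, for a unit vector [x] of the direct sum let
    [u = (|x_1|, ..., |x_n|)], a unit vector of C^n.  The triangle and
    Cauchy-Schwarz inequalities give [|<Tx, x>| <= <Su, u>], and the entrywise
    estimate gives [<Su, u> <= <Tmx u, u> = <Ru, u>], because [R] is the
    symmetric part of [Tmx] and [u] is real and nonnegative.  So the number
    [|<Tx, x>|] is at most both [|Su|] and [|Ru|], and its square is at most
    [a |Ru|^2 + (1 - a) |Su|^2 = <(a |R|^2 + (1 - a) |S|^2) u, u>] for every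
    [a] in [0, 1].  The minimum over [a] exists because the norm is Lipschitz
    in [a].  At [a = 1] the bound is the norm of the symmetric matrix [R],
    which polarization bounds by the numerical radius of [R], hence by that of
    [Tmx], the two quadratic forms having the same real part.  This is
    [numradius_norm_majorant], valid for any matrix majorizing the norms.

    The entrywise estimate [opnorm_le_cfc_sq] rests on the fact that the norm
    [l] of a nonzero operator [T] is an approximate eigenvalue of both [|T|]
    and [|T*|] (both are positive of norm [l]).  The functional calculus maps
    approximate eigenvalues to approximate eigenvalues, so
    [|f^2(|T|)| >= f(l)^2] and [|g^2(|T*|)| >= g(l)^2], and [f(l) g(l) = l].

    What remains is that adjoints, square roots of positive operators and the
    functional calculus exist, since the objects of the statement are chosen
    among the solutions of their defining conditions.  Adjoints come from the
    minimization of a coercive quadratic functional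
    ([coercive_representation]), which also inverts coercive symmetric
    operators and so locates the spectrum of a positive operator.  The
    functional calculus and the square root are limits of Bernstein polynomials
    evaluated at the operator.  They converge in norm for an algebraic reason: a
    polynomial in the cone generated by squares and by [X], [M - X]
    is nonnegative at every operator [0 <= A <= M], and the difference of two
    Bernstein polynomials of [f] lies within a small constant of zero for the
    order defined by this cone, by the usual second moment computation
    ([cone_bernstein2_bound]). *)

Import Order.TTheory GRing.Theory Num.Theory Num.Def.
Import numFieldNormedType.Exports.

Local Open Scope classical_set_scope.
Local Open Scope ring_scope.
Local Open Scope complex_scope.

(** * Moduli of complex numbers *)

Lemma Re_norm_sqr {R : realType} (z : R[i]) :
  complex.Re `|z| ^+ 2 = complex.Re ((z^*)%C * z).
Proof.
rewrite normc_def; case: z => u v /=.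
by rewrite sqr_sqrtr ?addr_ge0 ?sqr_ge0//; ring.
Qed.

Lemma im_le_norm {R : realType} (z : R[i]) : `|complex.Im z| <= complex.Re `|z|.
Proof.
rewrite normc_def; case: z => u v /=.
by rewrite -sqrtr_sqr ler_wsqrtr// lerDr sqr_ge0.
Qed.

Lemma Re_norm_le {R : realType} (z : R[i]) :
  complex.Re `|z| <= `|complex.Re z| + `|complex.Im z|.
Proof.
rewrite normc_def; case: z => a b /=.
rewrite -(ler_pXn2r (_ : 0 < 2)%N) ?nnegrE ?sqrtr_ge0 ?addr_ge0//.
rewrite sqr_sqrtr ?addr_ge0 ?sqr_ge0// -(real_normK (num_real a)) -(real_normK (num_real b)).
by have := mulr_ge0 (normr_ge0 a) (normr_ge0 b); nra.
Qed.

Lemma re_norm_ge {R : realType} (z : R[i]) : `|complex.Re z| <= complex.Re `|z|.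
Proof. by have := normc_ge_Re z; rewrite lecE => /andP[_]. Qed.

Lemma Re_normD {R : realType} (z w : R[i]) :
  complex.Re `|z + w| <= complex.Re `|z| + complex.Re `|w|.
Proof.
by have := ler_normD z w; rewrite lecE => /andP[_]; rewrite !normc_def.
Qed.

Lemma re_sub {R : realType} (z w : R[i]) : complex.Re (z - w) = complex.Re z - complex.Re w.
Proof. by case: z w => ? ? []. Qed.

Lemma im_sub {R : realType} (z w : R[i]) : complex.Im (z - w) = complex.Im z - complex.Im w.
Proof. by case: z w => ? ? []. Qed.

Lemma Re_norm_realM {R : realType} (a : R) (z : R[i]) :
  complex.Re `|a%:C * z| = `|a| * complex.Re `|z|.
Proof. by rewrite normrM !normc_def /= expr0n /= addr0 sqrtr_sqr mul0r subr0. Qed.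

Lemma re_le_norm {R : realType} (z : R[i]) : complex.Re z <= complex.Re `|z|.
Proof. by have := normc_ge_Re z; rewrite lecE /= => /andP[_]; apply/le_trans/ler_norm. Qed.

Lemma conjC_real {R : realType} (a : R) : conjC a%:C = a%:C.
Proof. exact: conjc_real. Qed.

(** * Inner products *)

Section InnerProduct.
Context {R : realType} {V : lmodType R[i]}.
Variable d : {dot V for conjC}.
Implicit Types (x y : V) (a : R).

Local Notation re x y := (complex.Re (d x y)).
Local Notation N := (hnorm d).

Lemma reDl x y z : re (x + y) z = re x z + re y z.
Proof. by rewrite linearDl /=; case: (d x z) (d y z) => ? ? []. Qed.

Lemma reNl x z : re (- x) z = - re x z.
Proof. by rewrite linearNl /=; case: (d x z). Qed.

Lemma reBl x y z : re (x - y) z = re x z - re y z.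
Proof. by rewrite reDl reNl. Qed.

Lemma dotC x y : d x y = ((d y x)^*)%C.
Proof. by rewrite hermC mul1r. Qed.

Lemma reC x y : re x y = re y x.
Proof. by rewrite dotC; case: (d y x). Qed.

Lemma reDr z x y : re z (x + y) = re z x + re z y.
Proof. by rewrite reC reDl !(reC _ z). Qed.

Lemma reNr z x : re z (- x) = - re z x.
Proof. by rewrite reC reNl (reC _ z). Qed.

Lemma reBr z x y : re z (x - y) = re z x - re z y.
Proof. by rewrite reDr reNr. Qed.

Lemma reZl a x y : re (a%:C *: x) y = a * re x y.
Proof. by rewrite linearZl_LR /=; case: (d x y) => u v /=; rewrite mul0r subr0. Qed.

Lemma reZr a x y : re x (a%:C *: y) = a * re x y.
Proof. by rewrite reC reZl reC. Qed.

Lemma re0l x : re 0 x = 0.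
Proof. by rewrite linear0l. Qed.

Lemma re0r x : re x 0 = 0.
Proof. by rewrite linear0r. Qed.

Lemma dot_self_real x : d x x = (re x x)%:C.
Proof. by have := dnorm_ge0 d x; case: (d x x) => u v; rewrite lecE /= => /andP[/eqP -> _]. Qed.

Lemma re_self_ge0 x : 0 <= re x x.
Proof. by have := dnorm_ge0 d x; rewrite lecE /= => /andP[]. Qed.

Lemma hnorm_ge0 x : 0 <= N x.
Proof. exact: sqrtr_ge0. Qed.

Lemma hnorm_sqr x : N x ^+ 2 = re x x.
Proof. by rewrite /hnorm sqr_sqrtr ?re_self_ge0. Qed.

Lemma hnorm0 : N 0 = 0.
Proof. by rewrite /hnorm re0l sqrtr0. Qed.

Lemma hnorm_eq0 x : (N x == 0) = (x == 0).
Proof.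
rewrite -(dnorm_eq0 d) dot_self_real -sqrf_eq0 hnorm_sqr.
by apply/eqP/eqP => [->//|[]].
Qed.

Lemma hnormB_sqr x y : N (x - y) ^+ 2 = N x ^+ 2 - 2 * re x y + N y ^+ 2.
Proof. by rewrite !hnorm_sqr reBl !reBr (reC y x); ring. Qed.

Lemma hnormN x : N (- x) = N x.
Proof. by rewrite /hnorm reNl reNr opprK. Qed.

Lemma hnorm_distC x y : N (x - y) = N (y - x).
Proof. by rewrite -opprB hnormN. Qed.

(** Cauchy-Schwarz, from the nonnegativity of the squared norm of
    [|y| x - |x| y]. *)
Lemma re_le_hnorm x y : re x y <= N x * N y.
Proof.
have [/eqP|x0] := eqVneq (N x) 0.
  by rewrite hnorm_eq0 => /eqP ->; rewrite re0l hnorm0 mul0r.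
have [/eqP|y0] := eqVneq (N y) 0.
  by rewrite hnorm_eq0 => /eqP ->; rewrite re0r hnorm0 mulr0.
have px : 0 < N x by rewrite lt_def x0 hnorm_ge0.
have py : 0 < N y by rewrite lt_def y0 hnorm_ge0.
have := re_self_ge0 ((N y)%:C *: x - (N x)%:C *: y).
rewrite reBl !reBr !reZl !reZr -!hnorm_sqr (reC y x) => h.
have : 0 <= (N x * N y) * (N x * N y - re x y) by nra.
by rewrite pmulr_rge0 ?mulr_gt0// subr_ge0.
Qed.

Lemma hnormD x y : N (x + y) <= N x + N y.
Proof.
rewrite -(ler_pXn2r (_ : 0 < 2)%N) ?nnegrE ?addr_ge0 ?hnorm_ge0//.
rewrite hnorm_sqr reDl !reDr (reC y x) -!hnorm_sqr.
by have := re_le_hnorm x y; nra.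
Qed.

Lemma hnormB x y : N (x - y) <= N x + N y.
Proof. by rewrite -(hnormN y) hnormD. Qed.

Lemma hnorm_triangle x y z : N (x - z) <= N (x - y) + N (y - z).
Proof. by rewrite -{1}(subrK y x) -addrA hnormD. Qed.

Lemma hnormZ (z : R[i]) x : N (z *: x) = complex.Re `|z| * N x.
Proof.
have z0 : 0 <= complex.Re `|z| by rewrite normc_def /= sqrtr_ge0.
apply/eqP; rewrite -(@eqrXn2 _ 2%N) ?mulr_ge0 ?hnorm_ge0//.
rewrite exprMn !hnorm_sqr dnormZ dot_self_real normc_def /=.
by rewrite !mul0r !mulr0 !subr0 expr2 eqxx.
Qed.

Lemma hnormZr a x : N (a%:C *: x) = `|a| * N x.
Proof. by rewrite hnormZ normc_def /= expr0n /= addr0 sqrtr_sqr. Qed.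

(** The modulus of [c = d x y] is recovered from the real part by rotating [x]
    by the conjugate of [c]. *)
Lemma dot_le_hnorm x y : complex.Re `|d x y| <= N x * N y.
Proof.
set c := d x y.
have h : complex.Re `|c| ^+ 2 = re ((c^*)%C *: x) y.
  by rewrite linearZl_LR /= -/c Re_norm_sqr.
have c0 : 0 <= complex.Re `|c| by rewrite normc_def /= sqrtr_ge0.
have := re_le_hnorm ((c^*)%C *: x) y; rewrite -h hnormZ normcJ => {}h.
have [->|cn] := eqVneq (complex.Re `|c|) 0; first by rewrite mulr_ge0 ?hnorm_ge0.
have cp : 0 < complex.Re `|c| by rewrite lt_def cn.
by rewrite -(ler_pM2l cp) mulrA -expr2.
Qed.

Lemma re_dot_le x y : `|re x y| <= N x * N y.
Proof. by rewrite ler_norml lerNl -reNl -{1}(hnormN x) !re_le_hnorm. Qed.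

End InnerProduct.

(** * Bounded operators, completeness and representation *)

Section Operators.
Context {R : realType} {V : lmodType R[i]}.
Variable d : {dot V for conjC}.
Implicit Types (A B P : V -> V) (x y : V).

Local Notation re x y := (complex.Re (d x y)).
Local Notation N := (hnorm d).

Lemma linopD A : linear A -> forall x y, A (x + y) = A x + A y.
Proof. by move=> h x y; rewrite -[x in LHS]scale1r h scale1r. Qed.

Lemma linop0 A : linear A -> A 0 = 0.
Proof. by move=> h; apply: (@addrI _ (A 0)); rewrite -linopD// !addr0. Qed.

Lemma linopZ A : linear A -> forall a x, A (a *: x) = a *: A x.
Proof. by move=> h a x; rewrite -[a *: x in LHS]addr0 h linop0// addr0. Qed.

Lemma linopN A : linear A -> forall x, A (- x) = - A x.
Proof. by move=> h x; rewrite -scaleN1r linopZ// scaleN1r. Qed.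

Lemma linopB A : linear A -> forall x y, A (x - y) = A x - A y.
Proof. by move=> h x y; rewrite linopD// linopN. Qed.

Lemma bounded_op_ge0 A : bounded_op d A ->
  exists2 M : R, 0 <= M & forall x, N (A x) <= M * N x.
Proof.
move=> [_ [M hM]]; exists `|M| => // x.
by apply: le_trans (hM x) _; rewrite ler_wpM2r ?hnorm_ge0 ?ler_norm.
Qed.

Lemma bounded_op_id : bounded_op d id.
Proof. by split=> //; exists 1 => x; rewrite mul1r. Qed.

Lemma bounded_op_comp A B : bounded_op d A -> bounded_op d B ->
  bounded_op d (fun x => A (B x)).
Proof.
move=> bA bB; split=> [a x y|]; first by rewrite bB.1 bA.1.
have [M M0 hM] := bounded_op_ge0 _ bA; have [K K0 hK] := bounded_op_ge0 _ bB.
exists (M * K) => x; apply: le_trans (hM _) _.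
by rewrite -mulrA ler_wpM2l.
Qed.

Lemma bounded_opD A B : bounded_op d A -> bounded_op d B ->
  bounded_op d (fun x => A x + B x).
Proof.
move=> bA bB; split=> [a x y|]; first by rewrite bB.1 bA.1 scalerDr addrACA.
have [M M0 hM] := bounded_op_ge0 _ bA; have [K K0 hK] := bounded_op_ge0 _ bB.
exists (M + K) => x; apply: le_trans (hnormD _ _ _) _.
by rewrite mulrDl lerD.
Qed.

Lemma bounded_opZ A c : bounded_op d A -> bounded_op d (fun x => c *: A x).
Proof.
move=> bA; split=> [a x y|].
  by rewrite bA.1 scalerDr !scalerA [c * a]mulrC.
have [M M0 hM] := bounded_op_ge0 _ bA.
exists (complex.Re `|c| * M) => x; rewrite hnormZ -mulrA ler_wpM2l//.
by rewrite normc_def /= sqrtr_ge0.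
Qed.

Lemma bounded_opB A B : bounded_op d A -> bounded_op d B ->
  bounded_op d (fun x => A x - B x).
Proof.
move=> bA bB; rewrite (_ : (fun x => _) = (fun x => A x + (-1) *: B x)).
  by apply: bounded_opD => //; exact: bounded_opZ.
by apply/funext => x; rewrite scaleN1r.
Qed.

Lemma opnorm_le P (c : R) : (forall x, N (P x) <= c * N x) -> 0 <= c ->
  opnorm d P <= c.
Proof.
move=> h c0; apply: ge_sup.
  by exists (N (P 0)), 0 => //=; rewrite hnorm0 ler01.
move=> _ [x /= x1 <-]; apply: le_trans (h x) _.
by rewrite -[leRHS]mulr1 ler_wpM2l.
Qed.

Lemma opnorm_ubound P : bounded_op d P ->
  has_ubound [set N (P x) | x in [set x | N x <= 1]].
Proof.
move=> bP; have [M M0 hM] := bounded_op_ge0 _ bP.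
exists M => _ [x /= x1 <-]; apply: le_trans (hM x) _.
by rewrite -[leRHS]mulr1 ler_wpM2l.
Qed.

Lemma opnorm_ge0 P : bounded_op d P -> 0 <= opnorm d P.
Proof.
move=> bP; apply: le_trans (hnorm_ge0 d (P 0)) _.
by apply: ub_le_sup; [exact: opnorm_ubound | exists 0 => //=; rewrite hnorm0].
Qed.

Lemma hnorm_le_opnorm P x : bounded_op d P -> N (P x) <= opnorm d P * N x.
Proof.
move=> bP; have [/eqP|x0] := eqVneq (N x) 0.
  by rewrite hnorm_eq0 => /eqP ->; rewrite (linop0 _ bP.1) hnorm0 mulr0.
have px : 0 < N x by rewrite lt_def x0 hnorm_ge0.
rewrite -ler_pdivrMr//.
have -> : N (P x) / N x = N (P ((N x)^-1%:C *: x)).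
  by rewrite (linopZ _ bP.1) hnormZr ger0_norm ?invr_ge0 ?ltW// mulrC.
apply: ub_le_sup; first exact: opnorm_ubound.
exists ((N x)^-1%:C *: x); last by [].
by rewrite /= hnormZr ger0_norm ?invr_ge0 ?hnorm_ge0// mulVf.
Qed.

Definition hconverges (u : nat -> V) (z : V) : Prop :=
  forall e : R, 0 < e -> exists n, forall k, (n <= k)%N -> N (u k - z) <= e.

Definition hcauchy (u : nat -> V) : Prop :=
  forall e : R, 0 < e -> exists n, forall k l, (n <= k)%N -> (n <= l)%N ->
    N (u k - u l) <= e.

(** Completeness is expressed with sequences and the norm of the form [d], so
    that it makes sense on a bare module and applies to H and to C^n alike. *)
Definition hcomplete : Prop :=
  forall u, hcauchy u -> exists z, hconverges u z.

Lemma invS_eventually_le (e : R) : 0 < e ->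
  exists n, forall k, (n <= k)%N -> k.+1%:R^-1 <= e.
Proof.
move=> e0; exists (Num.truncn e^-1) => k nk.
rewrite invf_ple ?posrE//; apply/ltW/(lt_le_trans (truncnS_gt _)).
by rewrite ler_nat ltnS.
Qed.

Definition symmetric_op A : Prop := forall x y, d (A x) y = d x (A y).

Lemma symmetric_re A x y : symmetric_op A -> re (A x) y = re x (A y).
Proof. by move=> ->. Qed.

(** Lax-Milgram for symmetric forms, by minimizing
    [J x = <Ax, x> - 2 Re (phi x)].  By the parallelogram identity a minimizing
    sequence is Cauchy, and vanishing of the first variation at its limit is
    the required equation.  For [A = id] this is the Riesz representation
    theorem; for [phi = <., y>] it solves [A z = y]. *)
Lemma coercive_representation A (c : R) (phi : V -> R[i]) :
  hcomplete -> bounded_op d A -> symmetric_op A ->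
  0 < c -> (forall x, c * N x ^+ 2 <= re (A x) x) ->
  linear_for *%R phi ->
  (exists K : R, forall x, complex.Re `|phi x| <= K * N x) ->
  exists z, forall x, d (A x) z = phi x.
Proof.
move=> cV [lA [M hM]] sA c0 coer lphi [K hK].
have phiD x y : phi (x + y) = phi x + phi y.
  by rewrite -[x in LHS]scale1r lphi mul1r.
have phi0 : phi 0 = 0 by apply: (@addrI _ (phi 0)); rewrite -phiD !addr0.
have phiZ a x : phi (a *: x) = a * phi x by rewrite -[a *: x in LHS]addr0 lphi phi0 addr0.
pose f x := complex.Re (phi x).
have fD x y : f (x + y) = f x + f y by rewrite /f phiD; case: (phi x) (phi y) => ? ? [].
have fZ (a : R) x : f (a%:C *: x) = a * f x.
  by rewrite /f phiZ; case: (phi x) => u v /=; rewrite mul0r subr0.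
pose q x := re (A x) x.
pose J x := q x - 2 * f x.
have q0 x : 0 <= q x by apply: le_trans (coer x); rewrite mulr_ge0 ?sqr_ge0 ?ltW.
have qZD (s : R) x h : q (x + s%:C *: h) = q x + 2 * s * re (A x) h + s ^+ 2 * q h.
  rewrite /q linopD// (linopZ _ lA) reDl !reDr !reZl !reZr.
  by rewrite (symmetric_re _ h x sA) (reC d h (A x)); ring.
have Jlb x : - (K ^+ 2 / c) <= J x.
  have := le_trans (re_le_norm (phi x)) (hK x); rewrite -/(f x) => h1.
  have h2 := coer x; rewrite -/(q x) in h2.
  have : 0 <= (c * N x - K) ^+ 2 / c by rewrite divr_ge0 ?sqr_ge0 ?ltW.
  have -> : (c * N x - K) ^+ 2 / c = c * N x ^+ 2 - 2 * (K * N x) + K ^+ 2 / c.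
    by field; rewrite gt_eqF.
  by rewrite /J; lra.
have hinf : has_inf (range J).
  by split; [exists (J 0), 0 | exists (- (K ^+ 2 / c)) => _ [x _ <-]].
set m := inf (range J).
have mJ x : m <= J x by apply: ge_inf; [exact: hinf.2 | exists x].
have /choice[u hu] : forall k : nat, exists x, J x <= m + k.+1%:R^-1.
  move=> k; have k0 : 0 < k.+1%:R^-1 :> R by [].
  by have [_ [x _ <-] /ltW] := inf_adherent k0 hinf; exists x.
(* Parallelogram identity for the quadratic part of [J]. *)
have par x y : q (x - y) / 2 = J x + J y - 2 * J ((2^-1)%:C *: (x + y)).
  rewrite /J fZ fD.
  have -> : x - y = x + (-1)%:C *: y by rewrite rmorphN1 scaleN1r.
  have -> : (2^-1)%:C *: (x + y) = 0 + (2^-1)%:C *: (x + 1%:C *: y).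
    by rewrite add0r scale1r.
  rewrite !qZD (linop0 _ lA) re0l.
  have -> : q 0 = 0 by rewrite /q re0r.
  by field.
have ucauchy : hcauchy u.
  move=> e e0; have e1 : 0 < c * e ^+ 2 / 4 by rewrite divr_gt0 ?mulr_gt0 ?exprn_gt0.
  have [n hn] := invS_eventually_le _ e1; exists n => k l nk nl.
  rewrite -(ler_pXn2r (_ : 0 < 2)%N) ?nnegrE ?hnorm_ge0 ?(ltW e0)//.
  rewrite -(ler_pM2l c0); apply: le_trans (coer _) _; rewrite -/(q _).
  have := par (u k) (u l); have := mJ ((2^-1)%:C *: (u k + u l)).
  have := hu k; have := hu l; have := hn _ nk; have := hn _ nl.
  by move: (l.+1%:R^-1) (k.+1%:R^-1) => rl rk; lra.
have [z hz] := cV _ ucauchy; exists z.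
(* First variation at [z]: the limit of [J (u k + s h) - J (u k) >= m - J (u k)],
   where only the pairing of [u k] with [A h] varies with [k]. *)
have key (s : R) h : 0 <= 2 * s * (re (A z) h - f h) + s ^+ 2 * q h.
  apply/ler_addgt0Pr => e e0.
  have e2 : 0 < e / 2 by rewrite divr_gt0.
  have [n1 h1] := invS_eventually_le _ e2.
  have e3 : 0 < e / 2 / (2 * `|s| * N (A h) + 1).
    by rewrite !divr_gt0// ltr_wpDl// !mulr_ge0 ?hnorm_ge0.
  have [n2 h2] := hz _ e3.
  set k := maxn n1 n2.
  have {}h1 := h1 k (leq_maxl _ _); have {}h2 := h2 k (leq_maxr _ _).
  have := mJ (u k + s%:C *: h); rewrite /J qZD fD fZ => h3.
  have h4 := hu k; rewrite /J in h4.
  have h5 : 2 * s * re (A (u k)) h <= 2 * s * re (A z) h + e / 2.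
    rewrite -lerBlDl -mulrBr -reBl -linopB// symmetric_re//.
    apply: le_trans (ler_norm _) _; rewrite !normrM normr_nat.
    apply: (@le_trans _ _ (2 * `|s| * (N (u k - z) * N (A h)))).
      by rewrite ler_wpM2l ?mulr_ge0 ?re_dot_le.
    rewrite ler_pdivlMr in h2; last by rewrite ltr_wpDl// !mulr_ge0 ?hnorm_ge0.
    have := hnorm_ge0 d (u k - z); nra.
  by move: (k.+1%:R^-1) h1 h4 => rk; lra.
have rez h : re (A z) h = f h.
  apply/eqP; rewrite -subr_eq0 -sqrf_eq0; set B := _ - _; apply/eqP.
  have w0 : 0 < q h + 1 by rewrite ltr_wpDl.
  (* [q h + 1] in place of [q h] covers the case [q h = 0]. *)
  have := key (- B / (q h + 1)) h; rewrite -/B.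
  have -> : 2 * (- B / (q h + 1)) * B + (- B / (q h + 1)) ^+ 2 * q h
     = - (B ^+ 2 * (q h + 2)) / (q h + 1) ^+ 2 by field; rewrite gt_eqF.
  rewrite pmulr_lge0 ?invr_gt0 ?exprn_gt0// oppr_ge0 pmulr_lle0; last by rewrite ltr_wpDl.
  by move=> h1; apply/eqP; rewrite eq_le h1 sqr_ge0.
move=> h; have e1 : re (A h) z = f h by rewrite symmetric_re// reC rez.
(* The imaginary part is the real part at [i h]. *)
have e2 : re (A ('i%C *: h)) z = f ('i%C *: h) by rewrite symmetric_re// reC rez.
move: e1 e2; rewrite (linopZ _ lA) linearZl_LR /= /f phiZ.
by case: (d _ _) (phi h) => u1 v1 [u2 v2] /= -> /eqP; rewrite !mul0r !sub0r !mul1r eqr_opp => /eqP ->.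
Qed.

End Operators.

(** * Adjoints, positivity and the spectrum *)

Section Adjoint.
Context {R : realType} {V : lmodType R[i]}.
Variable d : {dot V for conjC}.
Hypothesis cV : hcomplete d.
Implicit Types (A B P : V -> V) (x y : V).

Local Notation re x y := (complex.Re (d x y)).
Local Notation N := (hnorm d).

Lemma dot_inj u v : (forall x, d x u = d x v) -> u = v.
Proof.
move=> h; apply/eqP; rewrite -subr_eq0 -(hnorm_eq0 d) -sqrf_eq0 hnorm_sqr.
by rewrite reBr h subrr.
Qed.

Lemma adjoint_spec A : bounded_op d A ->
  bounded_op d (adjoint d A) /\ forall x y, d (A x) y = d x (adjoint d A y).
Proof.
move=> bA; apply: (@xgetPex _ (fun=> 0) [set B | bounded_op d B /\
  forall x y, d (A x) y = d x (B y)]).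
have /choice[B hB] : forall y, exists z, forall x, d x z = d (A x) y.
  move=> y; apply: (@coercive_representation R V d id 1 (fun x => d (A x) y) cV).
  - exact: bounded_op_id.
  - by [].
  - exact: ltr01.
  - by move=> x; rewrite mul1r hnorm_sqr.
  - by move=> a u v; rewrite bA.1 linearPl.
  - have [M M0 hM] := bounded_op_ge0 _ _ bA; exists (M * N y) => x.
    by apply: le_trans (dot_le_hnorm _ _ _) _; rewrite mulrAC ler_wpM2r ?hnorm_ge0.
exists B; split; last by move=> x y; rewrite hB.
split=> [a x y|].
  by apply: dot_inj => z; rewrite linearPr /= !hB linearPr.
have [M M0 hM] := bounded_op_ge0 _ _ bA; exists M => y.
have [->|ne] := eqVneq (N (B y)) 0; first by rewrite mulr_ge0 ?hnorm_ge0.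
have p0 : 0 < N (B y) by rewrite lt_def ne hnorm_ge0.
rewrite -(ler_pM2l p0) -expr2 hnorm_sqr hB.
apply: le_trans (re_le_hnorm _ _ _) _; rewrite mulrCA mulrA ler_wpM2r ?hnorm_ge0//.
Qed.

Lemma bounded_adjoint A : bounded_op d A -> bounded_op d (adjoint d A).
Proof. by case/adjoint_spec. Qed.

Lemma adjointE A x y : bounded_op d A -> d (A x) y = d x (adjoint d A y).
Proof. by case/adjoint_spec => _ ->. Qed.

Lemma adjoint_unique A B : bounded_op d A ->
  (forall x y, d (A x) y = d x (B y)) -> adjoint d A = B.
Proof.
by move=> bA h; apply/funext => y; apply: dot_inj => x; rewrite -adjointE.
Qed.

Lemma adjointK A : bounded_op d A -> adjoint d (adjoint d A) = A.
Proof.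
move=> bA; apply: adjoint_unique; first exact: bounded_adjoint.
by move=> x y; rewrite dotC -adjointE// -dotC.
Qed.

Lemma hnorm_opE A x : bounded_op d A -> N (A x) ^+ 2 = re (adjoint d A (A x)) x.
Proof. by move=> bA; rewrite hnorm_sqr adjointE// reC. Qed.

Lemma opnorm_adjoint_le A : bounded_op d A -> opnorm d A <= opnorm d (adjoint d A).
Proof.
move=> bA; have bA' := bounded_adjoint _ bA.
apply: opnorm_le; last exact: opnorm_ge0.
move=> x; have [->|ne] := eqVneq (N (A x)) 0.
  by rewrite mulr_ge0 ?hnorm_ge0 ?opnorm_ge0.
have p0 : 0 < N (A x) by rewrite lt_def ne hnorm_ge0.
rewrite -(ler_pM2l p0) -expr2 hnorm_opE//.
apply: le_trans (re_le_hnorm _ _ _) _; rewrite mulrA ler_wpM2r ?hnorm_ge0//.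
by rewrite mulrC hnorm_le_opnorm.
Qed.

Lemma opnorm_adjoint A : bounded_op d A -> opnorm d (adjoint d A) = opnorm d A.
Proof.
move=> bA; apply/eqP; rewrite eq_le opnorm_adjoint_le// andbT.
by rewrite -{2}(adjointK _ bA) opnorm_adjoint_le//; exact: bounded_adjoint.
Qed.

Definition positive_op A : Prop := forall x, 0 <= d (A x) x.

Lemma positive_re A x : positive_op A -> 0 <= re (A x) x.
Proof. by move=> /(_ x); rewrite lecE => /andP[]. Qed.

Lemma positive_opP A : symmetric_op d A -> (forall x, 0 <= re (A x) x) ->
  positive_op A.
Proof.
move=> sA h x; rewrite lecE h andbT; apply/eqP.
have : d (A x) x = ((d (A x) x)^*)%C by rewrite -dotC sA.
by case: (d _ _) => u v [] /= => h1; lra.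
Qed.

(** Polarization: the form is real at [x + y] and at [x + i y], which fixes the
    imaginary and the real part of [d (A x) y - conj (d (A y) x)]. *)
Lemma positive_symmetric A : linear A -> positive_op A -> symmetric_op d A.
Proof.
move=> lA pA.
have im0 x : complex.Im (d (A x) x) = 0.
  by have := pA x; rewrite lecE => /andP[/eqP].
move=> x y; rewrite (dotC d x (A y)).
have := im0 (x + y); have := im0 (x + 'i%C *: y).
rewrite !linopD// (linopZ _ lA) !(linearDl, linearDr) /=.
rewrite !(linearZl_LR, linearZr_LR) /=.
have := im0 x; have := im0 y.
case: (d (A x) x) (d (A y) y) (d (A x) y) (d (A y) x) => ? ? [? ?] [? ?] [? ?] /=.
by move=> -> -> h1 h2; congr Complex; lra.
Qed.

(** If [s (A - t)] is coercive for a sign [s], it is injective, it is onto by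
    [coercive_representation], and coercivity bounds its inverse. *)
Lemma coercive_not_in_spectrum A (s t : R) (c : R) : bounded_op d A ->
  symmetric_op d A -> s ^+ 2 = 1 -> 0 < c ->
  (forall x, c * N x ^+ 2 <= s * re (A x - t%:C *: x) x) ->
  ~ spectrum d A t%:C.
Proof.
move=> bA sA s1 c0 coer; apply.
pose C x := s%:C *: (A x - t%:C *: x).
have bC : bounded_op d C.
  apply: bounded_opZ; apply: bounded_opB => //.
  by apply: bounded_opZ; exact: bounded_op_id.
have sC : symmetric_op d C.
  move=> x y; rewrite /C linearZl_LR linearZr_LR /= conjC_real; congr (_ * _).
  by rewrite linearBl linearBr linearZl_LR linearZr_LR /= conjC_real sA.
have coerC x : c * N x ^+ 2 <= re (C x) x by rewrite /C reZl.
have /choice[B hB] : forall y, exists z, C z = y.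
  move=> y; have [z hz] : exists z, forall x, d (C x) z = d x y.
    apply: (coercive_representation d C c (fun x => d x y) cV bC sC c0 coerC).
      by move=> a u v; rewrite linearPl.
    by exists (N y) => x; rewrite mulrC dot_le_hnorm.
  by exists z; apply: dot_inj => x; rewrite -sC.
have Cinj x y : C x = C y -> x = y.
  move=> h; apply/eqP; rewrite -subr_eq0 -(hnorm_eq0 d) -sqrf_eq0.
  rewrite eq_le sqr_ge0 andbT -(pmulr_rle0 _ c0).
  by apply: le_trans (coerC _) _; rewrite (linopB _ bC.1) h subrr re0l.
have bB : bounded_op d B.
  split=> [a x y|]; first by apply: Cinj; rewrite hB bC.1 !hB.
  exists c^-1 => x; rewrite ler_pdivlMl//.
  have [->|ne] := eqVneq (N (B x)) 0; first by rewrite mulr0 hnorm_ge0.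
  have p0 : 0 < N (B x) by rewrite lt_def ne hnorm_ge0.
  rewrite -(ler_pM2l p0) mulrCA -expr2; apply: le_trans (coerC _) _.
  by rewrite hB mulrC re_le_hnorm.
have s1C : s%:C * s%:C = 1 :> R[i] by rewrite -rmorphM -expr2 s1 rmorph1.
exists (fun x => B (s%:C *: x)); split.
- split=> [a x y|].
    by rewrite scalerDr scalerA mulrC -scalerA bB.1.
  have [M M0 hM] := bounded_op_ge0 _ _ bB; exists (M * `|s|) => x.
  by apply: le_trans (hM _) _; rewrite hnormZr mulrA.
- by move=> x; apply: Cinj; rewrite hB.
- move=> x; have := hB (s%:C *: x); rewrite {1}/C => /(congr1 (fun u => s%:C *: u)).
  by rewrite !scalerA s1C !scale1r.
Qed.

Lemma spectrum_positive A (M t : R) : bounded_op d A -> positive_op A ->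
  (forall x, re (A x) x <= M * N x ^+ 2) -> spectrum d A t%:C -> 0 <= t <= M.
Proof.
move=> bA pA hM st; have sA := positive_symmetric _ bA.1 pA.
rewrite !leNgt; apply/andP; split; apply/negP => ht; move: st.
- apply: (coercive_not_in_spectrum A 1 t (- t)) => //; first by rewrite expr1n.
    by rewrite oppr_gt0.
  move=> x; rewrite mul1r reBl reZl -hnorm_sqr mulNr.
  by have := positive_re A x pA; lra.
- apply: (coercive_not_in_spectrum A (- 1) t (t - M)) => //.
  + by rewrite sqrrN expr1n.
  + by rewrite subr_gt0.
  + by move=> x; rewrite mulN1r reBl reZl -hnorm_sqr; have := hM x; lra.
Qed.

End Adjoint.

(** * Polynomials in an operator *)

Section PolynomialOperator.
Context {R : realType} {V : lmodType R[i]}.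
Variable d : {dot V for conjC}.
Implicit Types (A : V -> V) (x y : V) (p q : {poly R}).

Local Notation re x y := (complex.Re (d x y)).
Local Notation N := (hnorm d).

Lemma polyop_wide A p n x : (size p <= n)%N ->
  polyop A p x = \sum_(i < n) (p`_i)%:C *: iter i A x.
Proof.
move=> pn; rewrite /polyop (big_ord_widen n (fun i => (p`_i)%:C *: iter i A x))//.
rewrite big_mkcond; apply: eq_bigr => i _; case: ltnP => // h.
by rewrite nth_default// rmorph0 scale0r.
Qed.

Lemma polyopD A p q x : polyop A (p + q) x = polyop A p x + polyop A q x.
Proof.
pose n := maxn (size p) (size q).
rewrite !(polyop_wide _ _ n) ?leq_maxl ?leq_maxr ?size_polyD//.
by rewrite -big_split; apply: eq_bigr => i _ /=; rewrite coefD rmorphD scalerDl.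
Qed.

Lemma polyopC A c x : polyop A c%:P x = c%:C *: x.
Proof. by rewrite (polyop_wide _ _ 1) ?size_polyC_leq1// big_ord1 coefC. Qed.

Lemma polyopMX A p x : polyop A (p * 'X) x = polyop A p (A x).
Proof.
rewrite (polyop_wide _ _ (size p).+1) ?(leq_trans (size_polyMleq _ _)) ?size_polyX ?addn2//.
rewrite big_ord_recl coefMX /= scale0r add0r /polyop.
by apply: eq_bigr => i _; rewrite coefMX -iterSr.
Qed.

Lemma polyopX A x : polyop A 'X x = A x.
Proof. by rewrite -['X]mul1r polyopMX polyopC scale1r. Qed.

Lemma linear_polyop A p : linear A -> linear (polyop A p).
Proof.
move=> lA; elim/poly_ind: p => [|p c IH] a x y.
  by rewrite !polyopC !scale0r scaler0 addr0.
rewrite !polyopD !polyopMX !polyopC lA IH !scalerDr addrACA; congr (_ + (_ + _)).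
by rewrite !scalerA mulrC.
Qed.

Lemma polyopZ A c p x : polyop A (c *: p) x = c%:C *: polyop A p x.
Proof.
rewrite (polyop_wide _ _ (size p)) ?size_scale_leq// scaler_sumr.
by apply: eq_bigr => i _; rewrite coefZ rmorphM scalerA.
Qed.

Lemma polyopB A p q x : polyop A (p - q) x = polyop A p x - polyop A q x.
Proof. by rewrite -[- q]scaleN1r polyopD polyopZ rmorphN1 scaleN1r. Qed.

Lemma polyopM A p q x : linear A -> polyop A (p * q) x = polyop A p (polyop A q x).
Proof.
move=> lA; have lp := linear_polyop _ p lA.
elim/poly_ind: q x => [|q c IH] x.
  by rewrite mulr0 !polyopC !scale0r (linop0 _ lp).
rewrite mulrDr mulrA !polyopD !polyopMX IH polyopC (linopD _ lp) (linopZ _ lp).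
by rewrite mulrC mul_polyC polyopZ.
Qed.

Lemma bounded_polyop A p : bounded_op d A -> bounded_op d (polyop A p).
Proof.
move=> bA; elim/poly_ind: p => [|p c IH].
  rewrite (_ : polyop A 0 = fun x => 0 *: id x).
    by apply: bounded_opZ; exact: bounded_op_id.
  by apply/funext => x; rewrite polyopC.
rewrite (_ : polyop A _ = fun x => polyop A p (A x) + c%:C *: id x).
  apply: bounded_opD; first exact: bounded_op_comp.
  by apply: bounded_opZ; exact: bounded_op_id.
by apply/funext => x; rewrite polyopD polyopMX polyopC.
Qed.

Lemma polyop_comm A p x : linear A -> polyop A p (A x) = A (polyop A p x).
Proof.
by move=> lA; rewrite -{1}(polyopX A x) -polyopM// mulrC polyopM// polyopX.
Qed.

Lemma symmetric_polyop A p : linear A -> symmetric_op d A ->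
  symmetric_op d (polyop A p).
Proof.
move=> lA sA; elim/poly_ind: p => [|p c IH] x y.
  by rewrite !polyopC !scale0r linear0l linear0r.
rewrite !polyopD !polyopMX !polyopC linearDl linearDr /= IH sA polyop_comm//.
by rewrite linearZl_LR linearZr_LR /= conjC_real.
Qed.

End PolynomialOperator.

(** * Positivity certificates on [0, M] *)

Section Cone.
Context {R : realType}.
Variable M : R.
Hypothesis M0 : 0 < M.
Implicit Types p q : {poly R}.

(** The quadratic module of [0, M]: membership certifies that a polynomial is
    nonnegative on [0, M] in a form that can be read at operators. *)
Inductive interval_cone : {poly R} -> Prop :=
| cone_sq q : interval_cone (q ^+ 2)
| cone_X q : interval_cone ('X * q ^+ 2)
| cone_MX q : interval_cone ((M%:P - 'X) * q ^+ 2)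
| cone_add p q : interval_cone p -> interval_cone q -> interval_cone (p + q).

Lemma cone_mul_sq p q : interval_cone p -> interval_cone (p * q ^+ 2).
Proof.
elim=> [r|r|r|r s _ hr _ hs].
- by rewrite -exprMn; exact: cone_sq.
- by rewrite -mulrA -exprMn; exact: cone_X.
- by rewrite -mulrA -exprMn; exact: cone_MX.
- by rewrite mulrDl; exact: cone_add.
Qed.

Lemma cone_const (c : R) : 0 <= c -> interval_cone c%:P.
Proof.
by move=> c0; rewrite -(sqr_sqrtr c0) polyC_exp; exact: cone_sq.
Qed.

Lemma cone_scale (c : R) p : 0 <= c -> interval_cone p -> interval_cone (c%:P * p).
Proof.
by move=> c0 hp; rewrite -(sqr_sqrtr c0) polyC_exp mulrC; exact: cone_mul_sq.
Qed.

(** [M X (M - X) = X^2 (M - X) + (M - X)^2 X], so the product of the two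
    generators is already in the module; this makes the module closed under
    multiplication. *)
Lemma cone_X_MX q : interval_cone ('X * (M%:P - 'X) * q ^+ 2).
Proof.
have -> : 'X * (M%:P - 'X) * q ^+ 2 = M^-1%:P *
    ((M%:P - 'X) * ('X * q) ^+ 2 + 'X * ((M%:P - 'X) * q) ^+ 2).
  have h : M%:P * M^-1%:P = 1 :> {poly R} by rewrite -polyCM divff ?gt_eqF.
  transitivity ((M%:P * M^-1%:P) * ('X * (M%:P - 'X) * q ^+ 2)); last by ring.
  by rewrite h mul1r.
by apply: cone_scale; [rewrite invr_ge0 ltW|apply: cone_add; constructor].
Qed.

Lemma cone_mul_X p : interval_cone p -> interval_cone (p * 'X).
Proof.
elim=> [r|r|r|r s _ hr _ hs].
- by rewrite mulrC; exact: cone_X.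
- by rewrite mulrAC -expr2 -exprMn; exact: cone_sq.
- by rewrite mulrAC [_ * 'X]mulrC; exact: cone_X_MX.
- by rewrite mulrDl; exact: cone_add.
Qed.

Lemma cone_mul_MX p : interval_cone p -> interval_cone (p * (M%:P - 'X)).
Proof.
elim=> [r|r|r|r s _ hr _ hs].
- by rewrite mulrC; exact: cone_MX.
- by rewrite mulrAC; exact: cone_X_MX.
- by rewrite mulrAC -expr2 -exprMn; exact: cone_sq.
- by rewrite mulrDl; exact: cone_add.
Qed.

Lemma cone_mul p q : interval_cone p -> interval_cone q -> interval_cone (p * q).
Proof.
move=> hp; elim=> [r|r|r|r s _ hr _ hs].
- exact: cone_mul_sq.
- by rewrite mulrA; apply: cone_mul_sq; exact: cone_mul_X.
- by rewrite mulrA; apply: cone_mul_sq; exact: cone_mul_MX.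
- by rewrite mulrDr; exact: cone_add.
Qed.

(** Each generator becomes [|y|^2], [<Ay, y>] or [M |y|^2 - <Ay, y>] at
    [y = q(A) x], since [q(A)] is symmetric and commutes with [A]. *)
Lemma cone_polyop_ge0 {V : lmodType R[i]} (d : {dot V for conjC}) (A : V -> V) p :
  linear A -> symmetric_op d A ->
  (forall x, 0 <= complex.Re (d (A x) x) <= M * hnorm d x ^+ 2) ->
  interval_cone p -> forall x, 0 <= complex.Re (d (polyop A p x) x).
Proof.
move=> lA sA hA; have sq q r x : complex.Re (d (polyop A (r * q ^+ 2) x) x) =
    complex.Re (d (polyop A r (polyop A q x)) (polyop A q x)).
  rewrite expr2 mulrCA polyopM// symmetric_re; last exact: symmetric_polyop.
  by rewrite polyopM.
elim=> [q|q|q|q r _ hq _ hr] x.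
- by rewrite -[q ^+ 2]mul1r sq polyopC scale1r -hnorm_sqr sqr_ge0.
- by rewrite sq polyopX; case/andP: (hA (polyop A q x)).
- rewrite sq polyopB polyopC polyopX reBl reZl -hnorm_sqr subr_ge0.
  by case/andP: (hA (polyop A q x)).
- by rewrite polyopD reDl addr_ge0.
Qed.

(** The product of the two hypotheses is [e^2 - q^2], whose value at [A] is
    nonnegative, that is, [|q(A) x|^2 <= e^2 |x|^2]. *)
Lemma cone_polyop_norm {V : lmodType R[i]} (d : {dot V for conjC}) (A : V -> V) q e :
  linear A -> symmetric_op d A ->
  (forall x, 0 <= complex.Re (d (A x) x) <= M * hnorm d x ^+ 2) ->
  0 <= e -> interval_cone (e%:P - q) -> interval_cone (e%:P + q) ->
  forall x, hnorm d (polyop A q x) <= e * hnorm d x.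
Proof.
move=> lA sA hA e0 h1 h2 x.
rewrite -(ler_pXn2r (_ : 0 < 2)%N) ?nnegrE ?mulr_ge0 ?hnorm_ge0//.
rewrite hnorm_sqr -symmetric_re; last exact: symmetric_polyop.
rewrite -polyopM// -subr_ge0 exprMn (hnorm_sqr d x) -reZl -reBl.
have -> : (e ^+ 2)%:C *: x - polyop A (q * q) x
    = polyop A ((e%:P - q) * (e%:P + q)) x.
  by rewrite -(polyopC A) -polyopB polyC_exp; congr (polyop A _ x); ring.
exact: cone_polyop_ge0 (cone_mul _ _ h1 h2) x.
Qed.

End Cone.

(** * Bernstein approximation *)

Section Bernstein.
Context {S : comNzRingType}.
Variable u : S.
Implicit Types g h : nat -> S.

(** The expectation of [g] for a binomial variable with parameters [k] and [u],
    that is, the sum of ['C(k, j) u^j (1 - u)^(k - j) g j].  Conditioning on the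
    first trial makes linearity, positivity and the moments one-line
    inductions. *)
Fixpoint bernstein (k : nat) (g : nat -> S) : S :=
  if k is k'.+1 then (1 - u) * bernstein k' g + u * bernstein k' (g \o succn)
  else g 0%N.

Lemma eq_bernstein k g h : (forall j, (j <= k)%N -> g j = h j) ->
  bernstein k g = bernstein k h.
Proof.
elim: k g h => [|k IH] g h e /=; first exact: e.
by congr (_ * _ + _ * _); apply: IH => j jk /=; apply: e => //; exact: leqW.
Qed.

Lemma bernsteinD k g h :
  bernstein k (fun j => g j + h j) = bernstein k g + bernstein k h.
Proof.
by elim: k g h => [|k IH] g h //=; rewrite IH (IH (g \o succn) (h \o succn)); ring.
Qed.

Lemma bernsteinM k c g : bernstein k (fun j => c * g j) = c * bernstein k g.
Proof.
by elim: k g => [|k IH] g //=; rewrite IH (IH (g \o succn)); ring.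
Qed.

Lemma bernstein_const k c : bernstein k (fun=> c) = c.
Proof.
by elim: k => [|k IH] //=; rewrite (eq_bernstein _ (_ \o _) (fun=> c))// IH; ring.
Qed.

Lemma bernsteinB k g h :
  bernstein k (fun j => g j - h j) = bernstein k g - bernstein k h.
Proof.
by rewrite bernsteinD -[- bernstein k h]mulN1r -bernsteinM; congr (_ + _);
  apply: eq_bernstein => j _; rewrite mulN1r.
Qed.

(** Squared mean plus variance of [y + c j]. *)
Lemma bernstein_moment k (y c : S) :
  bernstein k (fun j => (y + c * j%:R) ^+ 2) =
  (y + c * k%:R * u) ^+ 2 + c ^+ 2 * k%:R * u * (1 - u).
Proof.
elim: k y => [|k IH] y /=; first by rewrite mulr0 mul0r addr0; ring.
rewrite IH (@eq_bernstein _ _ (fun j => (y + c + c * j%:R) ^+ 2)); last first.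
  by move=> j _ /=; rewrite -natr1; ring.
by rewrite IH -natr1; ring.
Qed.

Lemma bernstein_mean k (y c : S) :
  bernstein k (fun j => y + c * j%:R) = y + c * k%:R * u.
Proof.
elim: k y => [|k IH] y /=; first by rewrite !mulr0 mul0r.
rewrite IH (@eq_bernstein _ _ (fun j => (y + c + c * j%:R))); last first.
  by move=> j _ /=; rewrite -natr1; ring.
by rewrite IH -natr1; ring.
Qed.

End Bernstein.

Lemma horner_bernstein {R : comNzRingType} (u : {poly R}) k g (t : R) :
  (bernstein u k g).[t] = bernstein u.[t] k (fun j => (g j).[t]).
Proof.
elim: k g => [|k IH] g //=.
by rewrite hornerD !hornerM hornerD hornerN hornerC !IH.
Qed.

Lemma bernstein_ge0 {R : realDomainType} (u : R) k g : 0 <= u <= 1 ->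
  (forall j, (j <= k)%N -> 0 <= g j) -> 0 <= bernstein u k g.
Proof.
move=> /andP[u0 u1]; elim: k g => [|k IH] g hg /=; first exact: hg.
by rewrite addr_ge0// mulr_ge0 ?subr_ge0 ?IH// => j jk; apply: hg => //; exact: leqW.
Qed.

Section BernsteinInterval.
Context {R : realType}.
Variable M : R.
Hypothesis M0 : 0 < M.

Definition node (k j : nat) : R := M * j%:R / k.+1%:R.

Lemma node_itv k j : (j <= k.+1)%N -> 0 <= node k j <= M.
Proof.
move=> jk; rewrite /node; apply/andP; split.
  by rewrite divr_ge0 ?mulr_ge0 ?(ltW M0).
by rewrite ler_pdivrMr// ler_wpM2l ?(ltW M0)// ler_nat.
Qed.

Local Notation U := ('X * (M^-1)%:P : {poly R}).

Definition bernstein_poly (f : R -> R) (k : nat) : {poly R} :=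
  bernstein U k.+1 (fun j => (f (node k j))%:P).

Lemma cone_U : interval_cone M U.
Proof.
rewrite mulrC; apply: cone_scale; first by rewrite invr_ge0 (ltW M0).
by rewrite -['X]mulr1 -(expr1n _ 2); constructor.
Qed.

Lemma cone_1U : interval_cone M (1 - U).
Proof.
have -> : 1 - U = (M^-1)%:P * ((M%:P - 'X) * 1 ^+ 2).
  by rewrite expr1n mulr1 mulrBr -polyCM mulVf ?gt_eqF//; ring.
by apply: cone_scale; [rewrite invr_ge0 (ltW M0)|constructor].
Qed.

Lemma cone_bernstein k (g : nat -> {poly R}) :
  (forall j, (j <= k)%N -> interval_cone M (g j)) -> interval_cone M (bernstein U k g).
Proof.
have cu := cone_U; have cv := cone_1U.
elim: k g => [|k IH] g hg /=; first exact: hg.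
apply: cone_add; apply: cone_mul => //; apply: IH => j jk; apply: hg => //.
exact: leqW.
Qed.

Lemma bernstein_node_moment {S : comNzRingType} (h : {rmorphism R -> S}) (u y : S) k :
  bernstein u k.+1 (fun j => (y - h (node k j)) ^+ 2) =
  (y - h M * u) ^+ 2 + h (M ^+ 2 / k.+1%:R) * (u * (1 - u)).
Proof.
rewrite (@eq_bernstein _ _ _ _ (fun j => (y + - h (M / k.+1%:R) * j%:R) ^+ 2)).
  rewrite bernstein_moment -(rmorph_nat h) mulNr -rmorphM /= mulfVK ?gt_eqF//.
  rewrite sqrrN -rmorphXn -rmorphM mulNr /=; congr (_ + _).
  rewrite -mulrA; congr (h _ * _); field.
  by rewrite gt_eqF// -natr1 ltr_wpDl.
by move=> j _; rewrite /node mulrAC [h (_ * j%:R)]rmorphM rmorph_nat mulNr.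
Qed.

(** Chebyshev's argument for two independent binomial variables, in the order
    of the cone.  Replacing [F i j] by its bound leaves
    [e + C M^2 (1/(k+1) + 1/(l+1)) U (1 - U)], where [U = X / M], and
    [1 - U (1 - U) = (1 - U) + U^2] is in the cone. *)
Lemma cone_bernstein2_bound k l (F : nat -> nat -> R) (e C : R) : 0 <= C ->
  (forall i j, (i <= k.+1)%N -> (j <= l.+1)%N ->
     F i j <= e + C * (node k i - node l j) ^+ 2) ->
  interval_cone M ((e + C * M ^+ 2 * (k.+1%:R^-1 + l.+1%:R^-1))%:P -
    bernstein U k.+1 (fun i => bernstein U l.+1 (fun j => (F i j)%:P))).
Proof.
move=> C0 hF.
pose G i j : {poly R} := (e + C * (node k i - node l j) ^+ 2)%:P.
have MU : M%:P * U = 'X by rewrite mulrCA -polyCM divff ?gt_eqF// mulr1.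
have EG : bernstein U k.+1 (fun i => bernstein U l.+1 (G i)) =
  e%:P + C%:P * ((M ^+ 2 / k.+1%:R)%:P * (U * (1 - U)) +
                 (M ^+ 2 / l.+1%:R)%:P * (U * (1 - U))).
  transitivity (bernstein U k.+1 (fun i => (e%:P + C%:P * ((M ^+ 2 / l.+1%:R)%:P * (U * (1 - U))))
     + C%:P * ('X - (node k i)%:P) ^+ 2)).
    apply: eq_bernstein => i _.
    transitivity (bernstein U l.+1 (fun j => e%:P + C%:P * ((node k i)%:P - (node l j)%:P) ^+ 2)).
      by apply: eq_bernstein => j _; rewrite /G polyCD polyCM polyC_exp polyCB.
    rewrite bernsteinD bernstein_const bernsteinM.
    rewrite (bernstein_node_moment (@polyC R)) /= MU -addrA; congr (_ + _).
    ring.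
  rewrite bernsteinD bernstein_const bernsteinM.
  rewrite (bernstein_node_moment (@polyC R)) /= MU subrr expr0n /= add0r; ring.
have -> : (e + C * M ^+ 2 * (k.+1%:R^-1 + l.+1%:R^-1))%:P -
    bernstein U k.+1 (fun i => bernstein U l.+1 (fun j => (F i j)%:P)) =
   (C * M ^+ 2 * (k.+1%:R^-1 + l.+1%:R^-1))%:P * (1 - U + U ^+ 2) +
   bernstein U k.+1 (fun i => bernstein U l.+1 (fun j => G i j - (F i j)%:P)).
  rewrite (@eq_bernstein _ _ _ (fun i => bernstein U l.+1 (fun j => G i j - (F i j)%:P))
     (fun i => bernstein U l.+1 (G i) - bernstein U l.+1 (fun j => (F i j)%:P))); last first.
    by move=> i _; rewrite bernsteinB.
  rewrite bernsteinB EG !polyCD !polyCM !polyCD; ring.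
apply: cone_add.
  apply: cone_scale; first by rewrite mulr_ge0 ?addr_ge0 ?mulr_ge0 ?exprn_ge0 ?(ltW M0).
  by apply: cone_add; [exact: cone_1U|exact: cone_sq].
apply: cone_bernstein => i ik; apply: cone_bernstein => j jl.
by rewrite /G -polyCB; apply: cone_const; rewrite subr_ge0 hF.
Qed.

Lemma bernstein_poly_horner (f : R -> R) (k : nat) (e C t : R) : 0 <= C ->
  (forall s s', 0 <= s <= M -> 0 <= s' <= M -> `|f s - f s'| <= e + C * (s - s') ^+ 2) ->
  0 <= t <= M -> `|(bernstein_poly f k).[t] - f t| <= e + C * M ^+ 2 / k.+1%:R.
Proof.
move=> C0 hf tM; rewrite /bernstein_poly horner_bernstein hornerM hornerX hornerC.
set u := t / M.
have u01 : 0 <= u <= 1.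
  by case/andP: tM => t0 t1; rewrite divr_ge0 ?(ltW M0)//= ler_pdivrMr// mul1r.
rewrite (@eq_bernstein _ _ _ _ (fun j => f (node k j))); last by move=> j _; rewrite hornerC.
pose g j := e + C * (t - node k j) ^+ 2.
have Eg : bernstein u k.+1 g = e + C * (M ^+ 2 / k.+1%:R * (u * (1 - u))).
  rewrite /g bernsteinD bernstein_const bernsteinM.
  rewrite (bernstein_node_moment (@idfun R)) /=.
  by rewrite /u mulrCA divff ?gt_eqF// mulr1 subrr expr0n /= add0r.
have gle : bernstein u k.+1 g <= e + C * M ^+ 2 / k.+1%:R.
  rewrite Eg lerD2l -[leRHS]mulrA ler_wpM2l// -[leRHS]mulr1 ler_wpM2l//.
    by rewrite divr_ge0 ?sqr_ge0.
  by case/andP: u01 => ? ?; nra.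
have pt s : bernstein u k.+1 (fun=> s) = s by rewrite bernstein_const.
rewrite ler_norml -(pt (f t)); apply/andP; split.
  rewrite lerNl (le_trans _ gle)// -subr_ge0 opprB -bernsteinB -bernsteinB.
  apply: bernstein_ge0 => // j jk; rewrite subr_ge0.
  by apply: le_trans (ler_norm _) (hf _ _ tM (node_itv _ _ jk)).
rewrite (le_trans _ gle)// -bernsteinB -subr_ge0 -bernsteinB.
apply: bernstein_ge0 => // j jk; rewrite subr_ge0 (le_trans (ler_norm _))//.
by rewrite distrC; exact: (hf _ _ tM (node_itv _ _ jk)).
Qed.

End BernsteinInterval.

(** Near the diagonal [e] suffices by continuity; away from it [C (s - t)^2]
    exceeds twice the maximum of [|f|].  Compactness makes [C] uniform. *)
Lemma continuous_quadratic_modulus {R : realType} (f : R -> R) (M : R) :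
  {within `[0, +oo[, continuous f} -> forall e, 0 < e ->
  exists2 C, 0 <= C & forall s t, 0 <= s <= M -> 0 <= t <= M ->
    `|f s - f t| <= e + C * (s - t) ^+ 2.
Proof.
move=> cf e e0.
have cfM : {within `[0, M], continuous f}.
  by apply: continuous_subspaceW cf => x /=; rewrite !in_itv /= andbT => /andP[].
have kM : compact (`[0, M] : set R) by exact: segment_compact.
have [K K0 hK] : exists2 K, 0 < K & forall s, 0 <= s <= M -> `|f s| <= K.
  have := compact_bounded (continuous_compact cfM kM).
  move=> [K [_ hK]]; exists (`|K| + 1); first by rewrite ltr_wpDl.
  move=> s sM; apply: (hK (`|K| + 1)); first by rewrite ltr_pwDr// ler_norm.
  by exists s => //=; rewrite in_itv.
pose P (C s : R) := 0 <= s <= M -> forall t, 0 <= t <= M ->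
   `|f s - f t| <= e + C * (s - t) ^+ 2.
have : \forall C \near +oo, `[0, M] `<=` P C.
  move/compact_near_coveringP: kM; apply => s0 /= s0M.
  have /cvgrPdist_lt/(_ _ (divr_gt0 e0 (ltr0n _ 2))) :=
    (subspace_continuousP (`[0, M]) f).1 cfM s0 s0M.
  rewrite /prop_near1/= withinE /= => -[W [d /= d0 dW] hW].
  have close s : `|s0 - s| < d -> 0 <= s <= M -> `|f s0 - f s| < e / 2.
    move=> sd sM; have : (W `&` `[0, M]) s by split; [exact: dW | rewrite /= in_itv].
    by rewrite -hW => -[].
  exists (ball s0 (d / 2), [set C | 8 * K / d ^+ 2 <= C]) => /=.
    split; first by apply: nbhsx_ballx; rewrite divr_gt0.
    by apply: nbhs_pinfty_ge; exact: num_real.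
  move=> [s C] /= [sd hC] sM t tM; rewrite /ball /= in sd.
  have C0 : 0 <= C by apply: le_trans hC; rewrite !mulr_ge0 ?invr_ge0 ?exprn_ge0 ?ltW.
  have [st|st] := ltP `|s - t| (d / 2).
    have h1 : `|f s0 - f s| < e / 2 by apply: close => //; lra.
    have h2 : `|f s0 - f t| < e / 2.
      apply: close => //; rewrite -(subrK s s0) -addrA.
      by apply: le_lt_trans (ler_normD _ _) _; lra.
    have : `|f s - f t| <= `|f s0 - f s| + `|f s0 - f t|.
      by rewrite [X in _ <= X + _]distrC -{1}(subrK (f s0) (f s)) -addrA ler_normD.
    by have := mulr_ge0 C0 (sqr_ge0 (s - t)); lra.
  have h1 : `|f s - f t| <= 2 * K.
    by apply: le_trans (ler_normB _ _) _; have := hK _ sM; have := hK _ tM; lra.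
  have h2 : (d / 2) ^+ 2 <= (s - t) ^+ 2.
    by rewrite -(real_normK (num_real (s - t))) ler_pXn2r ?nnegrE// divr_ge0 ?ltW.
  have h3 : 8 * K / d ^+ 2 * (d / 2) ^+ 2 = 2 * K by field; rewrite gt_eqF.
  have : 2 * K <= C * (s - t) ^+ 2.
    by rewrite -h3 ler_pM// ?sqr_ge0// !mulr_ge0 ?invr_ge0 ?exprn_ge0 ?ltW.
  by lra.
move=> [C0 [_ hC]]; exists (`|C0| + 1) => [//|s t sM tM].
by apply: (hC (`|C0| + 1)) => //; rewrite ltr_pwDr ?ler_norm.
Qed.

(** [(sqrt s - sqrt t)^2 <= |s - t|], and the arithmetic-geometric inequality
    bounds [|s - t|]. *)
Lemma sqrt_sub_sqr {R : realType} (e s t : R) : 0 < e -> 0 <= s -> 0 <= t ->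
  (Num.sqrt s - Num.sqrt t) ^+ 2 <= e + (4 * e)^-1 * (s - t) ^+ 2.
Proof.
move=> e0 s0 t0; have h1 : (Num.sqrt s - Num.sqrt t) ^+ 2 <= `|s - t|.
  rewrite -{2}(sqr_sqrtr s0) -{2}(sqr_sqrtr t0) subr_sqr normrM.
  rewrite -(real_normK (num_real (_ - _))) expr2 ler_wpM2l//.
  rewrite [leRHS]ger0_norm ?addr_ge0 ?sqrtr_ge0//.
  by rewrite (le_trans (ler_normB _ _))// !ger0_norm ?sqrtr_ge0.
apply: le_trans h1 _; rewrite -(real_normK (num_real (s - t))).
set r := `|s - t|; rewrite -subr_ge0.
have -> : e + (4 * e)^-1 * r ^+ 2 - r = (r - 2 * e) ^+ 2 / (4 * e).
  by field; rewrite gt_eqF.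
by rewrite divr_ge0 ?sqr_ge0// mulr_ge0 ?ltW.
Qed.

(** * Functional calculus and square roots *)

Section Limits.
Context {R : realType} {V : lmodType R[i]}.
Variable d : {dot V for conjC}.
Hypothesis cV : hcomplete d.
Implicit Types (A B P : V -> V) (x y : V).

Local Notation re x y := (complex.Re (d x y)).
Local Notation N := (hnorm d).

Definition op_converges (P : nat -> V -> V) B : Prop :=
  forall e : R, 0 < e -> exists n, forall k, (n <= k)%N ->
    forall x, N (P k x - B x) <= e * N x.

Lemma op_cauchy_converges (P : nat -> V -> V) :
  (forall k, bounded_op d (P k)) ->
  (forall e : R, 0 < e -> exists n, forall k l, (n <= k)%N -> (n <= l)%N ->
     forall x, N (P k x - P l x) <= e * N x) ->
  exists B, bounded_op d B /\ op_converges P B.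
Proof.
move=> bP cP.
have /choice[B hB] : forall x, exists z, hconverges d (P ^~ x) z.
  move=> x; apply: cV => e e0.
  have e1 : 0 < e / (N x + 1) by rewrite divr_gt0// ltr_wpDl// hnorm_ge0.
  have [n hn] := cP _ e1; exists n => k l nk nl.
  apply: le_trans (hn _ _ nk nl x) _.
  rewrite mulrAC ler_pdivrMr ?ltr_wpDl ?hnorm_ge0//.
  by rewrite ler_wpM2l ?(ltW e0)// lerDl.
have convB : op_converges P B.
  move=> e e0; have [n hn] := cP _ e0; exists n => k nk x.
  apply/ler_addgt0Pr => e' e'0; have [m hm] := hB x _ e'0.
  apply: le_trans (hnorm_triangle _ _ (P (maxn n m) x) _) _.
  by rewrite lerD ?hn ?leq_maxl ?hm ?leq_maxr.
exists B; split=> //; split=> [a x y|].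
  apply/eqP; rewrite -subr_eq0 -(hnorm_eq0 d) eq_le hnorm_ge0 andbT.
  apply/ler_addgt0Pr => e e0; rewrite add0r.
  pose c := complex.Re `|a| + 2.
  have ca : 0 <= complex.Re `|a| by rewrite normc_def /= sqrtr_ge0.
  have c0 : 0 < c by rewrite ltr_wpDl.
  have e1 : 0 < e / c by rewrite divr_gt0.
  have [n1 h1] := hB x _ e1; have [n2 h2] := hB y _ e1.
  have [n3 h3] := hB (a *: x + y) _ e1.
  pose k := maxn n1 (maxn n2 n3).
  have {}h1 := h1 k (leq_maxl _ _).
  have {}h2 : N (P k y - B y) <= e / c by apply: h2; rewrite !leq_max leqnn orbT.
  have {}h3 : N (P k (a *: x + y) - B (a *: x + y)) <= e / c.
    by apply: h3; rewrite !leq_max leqnn !orbT.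
  have -> : B (a *: x + y) - (a *: B x + B y) =
      a *: (P k x - B x) + (P k y - B y) - (P k (a *: x + y) - B (a *: x + y)).
    rewrite (bP k).1 scalerBr opprB [a *: P k x - _ + _]addrACA -opprD.
    by rewrite [RHS]addrC [RHS]addrA subrK.
  apply: le_trans (hnormB _ _ _) _.
  have h4 := hnormD d (a *: (P k x - B x)) (P k y - B y).
  have : e = complex.Re `|a| * (e / c) + e / c + e / c by rewrite /c; field; rewrite gt_eqF.
  move: h4; rewrite hnormZ => h4 ->.
  by rewrite lerD// (le_trans h4)// lerD// ler_wpM2l.
have [n hn] := convB _ ltr01; have [M M0 hM] := bounded_op_ge0 _ _ (bP n).
exists (1 + M) => x; rewrite -[B x](subrK (P n x)) mulrDl.
apply: le_trans (hnormD _ _ _) _.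
by rewrite lerD// hnorm_distC hn.
Qed.

Lemma op_converges_opnorm (P : nat -> V -> V) B : op_converges P B ->
  (forall k, bounded_op d (P k)) -> bounded_op d B ->
  opnorm d (fun x => P k x - B x) @[k --> \oo] --> (0 : R).
Proof.
move=> cP bP bB; apply/cvgrPdist_le => e e0; have [n hn] := cP _ e0.
exists n => // k /= nk; rewrite sub0r normrN ger0_norm.
  by apply: opnorm_le; [exact: hn|exact: ltW].
by apply: opnorm_ge0; exact: bounded_opB.
Qed.

Section FunctionalCalculus.
Variables (A : V -> V) (M : R).
Hypotheses (M0 : 0 < M) (bA : bounded_op d A) (pA : positive_op d A).
Hypothesis hA : forall x, re (A x) x <= M * N x ^+ 2.

Let sA : symmetric_op d A. Proof. exact: positive_symmetric bA.1 pA. Qed.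
Let hA' x : 0 <= re (A x) x <= M * N x ^+ 2.
Proof. by rewrite positive_re//=. Qed.

(** The difference of two Bernstein polynomials is the double expectation of
    [f (x_i) - f (y_j)], to which the quadratic modulus of continuity applies. *)
Lemma bernstein_polyop_cauchy (f : R -> R) :
  {within `[0, +oo[, continuous f} ->
  forall e : R, 0 < e -> exists n, forall k l, (n <= k)%N -> (n <= l)%N ->
    forall x, N (polyop A (bernstein_poly M f k) x -
                 polyop A (bernstein_poly M f l) x) <= e * N x.
Proof.
move=> cf e e0; have e2 : 0 < e / 2 by rewrite divr_gt0.
have [C C0 hC] := continuous_quadratic_modulus f M cf _ e2.
have CM0 : 0 <= C * M ^+ 2 by rewrite mulr_ge0 ?sqr_ge0.
have e3 : 0 < e / 4 / (C * M ^+ 2 + 1) by rewrite !divr_gt0// ltr_wpDl.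
have [n hn] := invS_eventually_le _ e3; exists n => k l nk nl x.
set r := C * M ^+ 2 * (k.+1%:R^-1 + l.+1%:R^-1).
have r0 : 0 <= r by rewrite mulr_ge0 ?addr_ge0.
have re2 : r <= e / 2.
  have := hn _ nk; have := hn _ nl; rewrite /r.
  move: (k.+1%:R^-1) (l.+1%:R^-1) => a b.
  rewrite !ler_pdivlMr; try by rewrite ltr_wpDl.
  rewrite !mulrDr !mulr1 => ha hb; nra.
have H : bernstein_poly M f k - bernstein_poly M f l =
    bernstein ('X * (M^-1)%:P) k.+1 (fun i => bernstein ('X * (M^-1)%:P) l.+1
      (fun j => (f (node M k i) - f (node M l j))%:P)).
  rewrite /bernstein_poly -[X in _ - X](bernstein_const ('X * (M^-1)%:P) k.+1).
  rewrite -bernsteinB; apply: eq_bernstein => i _.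
  rewrite -[X in X - _](bernstein_const ('X * (M^-1)%:P) l.+1) -bernsteinB.
  by apply: eq_bernstein => j _; rewrite polyCB.
have H' : - (bernstein_poly M f k - bernstein_poly M f l) =
    bernstein ('X * (M^-1)%:P) k.+1 (fun i => bernstein ('X * (M^-1)%:P) l.+1
      (fun j => (f (node M l j) - f (node M k i))%:P)).
  rewrite H -mulN1r -bernsteinM; apply: eq_bernstein => i _.
  rewrite -bernsteinM; apply: eq_bernstein => j _.
  by rewrite mulN1r -polyCN opprB.
apply: (@le_trans _ _ ((e / 2 + r) * N x)); last first.
  by rewrite ler_wpM2r ?hnorm_ge0//; lra.
rewrite -polyopB; apply: (cone_polyop_norm M M0 d A _ _ bA.1 sA hA').
- by lra.
- rewrite H; apply: cone_bernstein2_bound => // i j ik jl.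
  by apply: le_trans (ler_norm _) _; apply: hC; exact: node_itv.
- rewrite -[bernstein_poly _ _ _ - _]opprK H'.
  apply: cone_bernstein2_bound => // i j ik jl.
  by apply: le_trans (ler_norm _) _; rewrite distrC; apply: hC; exact: node_itv.
Qed.

Lemma bernstein_polyop_converges (f : R -> R) :
  {within `[0, +oo[, continuous f} ->
  exists B, bounded_op d B /\
    op_converges (fun k => polyop A (bernstein_poly M f k)) B.
Proof.
move=> cf; apply: op_cauchy_converges; first by move=> k; exact: bounded_polyop.
exact: bernstein_polyop_cauchy.
Qed.

Lemma is_cfc_exists (f : R -> R) : {within `[0, +oo[, continuous f} ->
  exists B, is_cfc d A f B.
Proof.
move=> cf; have [B [bB cB]] := bernstein_polyop_converges _ cf.
exists B; split=> //; exists (bernstein_poly M f); split; last first.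
  by apply: op_converges_opnorm => // k; exact: bounded_polyop.
move=> e e0; have e2 : 0 < e / 2 by rewrite divr_gt0.
have [C C0 hC] := continuous_quadratic_modulus f M cf _ e2.
have CM0 : 0 <= C * M ^+ 2 by rewrite mulr_ge0 ?sqr_ge0.
have e3 : 0 < e / 4 / (C * M ^+ 2 + 1) by rewrite !divr_gt0// ltr_wpDl.
have [n hn] := invS_eventually_le _ e3; exists n => // k /= nk t st.
have tM := spectrum_positive d cV A M t bA pA hA st.
apply: le_lt_trans (bernstein_poly_horner M M0 f k _ _ _ C0 hC tM) _.
have := hn _ nk; move: (k.+1%:R^-1) => a.
by rewrite ler_pdivlMr ?ltr_wpDl// mulrDr mulr1 => ha; nra.
Qed.

(** As [X] is the mean of the nodes [x_i], one has [X = E E (x_i + x_j) / 2]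
    and [p^2 = E E (sqrt x_i sqrt x_j)]; the difference is a square. *)
Lemma bernstein_sqrt_square k : 'X - bernstein_poly M Num.sqrt k ^+ 2 =
  bernstein ('X * (M^-1)%:P) k.+1 (fun i => bernstein ('X * (M^-1)%:P) k.+1
   (fun j => (2^-1 * (Num.sqrt (node M k i) - Num.sqrt (node M k j)) ^+ 2)%:P)).
Proof.
set U := 'X * _; set p := bernstein_poly M Num.sqrt k.
have EX : bernstein U k.+1 (fun j => (node M k j)%:P) = 'X.
  rewrite (@eq_bernstein _ _ _ _ (fun j => 0 + (M / k.+1%:R)%:P * j%:R)).
    rewrite bernstein_mean add0r -(rmorph_nat (@polyC R)) -polyCM divfK ?pnatr_eq0//.
    by rewrite /U mulrCA -polyCM divff ?gt_eqF// mulr1.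
  by move=> j _; rewrite add0r /node -(rmorph_nat (@polyC R)) -polyCM mulrAC.
pose s j := Num.sqrt (node M k j).
transitivity (bernstein U k.+1 (fun i => (2^-1)%:P * (node M k i)%:P +
    (2^-1)%:P * 'X - (s i)%:P * p)).
  rewrite bernsteinB bernsteinD bernstein_const bernsteinM EX.
  rewrite (@eq_bernstein _ _ _ _ (fun i => p * (s i)%:P)); last by move=> i _; rewrite mulrC.
  rewrite bernsteinM -expr2 -mulrDl -polyCD.
  by rewrite (_ : 2^-1 + 2^-1 = 1) ?mul1r//; field.
apply: eq_bernstein => i ik.
transitivity (bernstein U k.+1 (fun j => (2^-1)%:P * (node M k i)%:P +
    (2^-1)%:P * (node M k j)%:P - (s i)%:P * (s j)%:P)).
  by rewrite bernsteinB bernsteinD bernstein_const !bernsteinM EX.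
apply: eq_bernstein => j jk; rewrite -/(s i) -/(s j) -!polyCM -polyCD -polyCB.
congr (_ %:P).
have /andP[n1 _] := node_itv M M0 k i ik; have /andP[n2 _] := node_itv M M0 k j jk.
by rewrite -{1}(sqr_sqrtr n1) -{1}(sqr_sqrtr n2) -/(s i) -/(s j); field.
Qed.

Lemma bernstein_sqrt_polyop (e : R) : 0 < e ->
  exists n, forall k, (n <= k)%N -> forall x,
    N (A x - polyop A (bernstein_poly M Num.sqrt k ^+ 2) x) <= e * N x.
Proof.
move=> e0; have e2 : 0 < e / 2 by rewrite divr_gt0.
pose C := (4 * (e / 2))^-1.
have C0 : 0 <= C by rewrite invr_ge0 mulr_ge0 ?ltW.
have CM0 : 0 <= C * M ^+ 2 by rewrite mulr_ge0 ?sqr_ge0.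
have e3 : 0 < e / 4 / (C * M ^+ 2 + 1) by rewrite !divr_gt0// ltr_wpDl.
have [n hn] := invS_eventually_le _ e3; exists n => k nk x.
set r := C * M ^+ 2 * (k.+1%:R^-1 + k.+1%:R^-1).
have r0 : 0 <= r by rewrite mulr_ge0 ?addr_ge0.
have re2 : r <= e / 2.
  have := hn _ nk; rewrite /r; move: (k.+1%:R^-1) => a.
  rewrite !ler_pdivlMr ?ltr_wpDl// !mulrDr !mulr1 => ha; nra.
apply: (@le_trans _ _ ((e / 2 + r) * N x)); last first.
  by rewrite ler_wpM2r ?hnorm_ge0//; lra.
rewrite -{1}(polyopX A x) -polyopB; apply: (cone_polyop_norm M M0 d A _ _ bA.1 sA hA').
- by lra.
- rewrite bernstein_sqrt_square; apply: cone_bernstein2_bound => // i j ik jl.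
  have /andP[n1 _] := node_itv M M0 k i ik; have /andP[n2 _] := node_itv M M0 k j jl.
  have := sqrt_sub_sqr _ _ _ e2 n1 n2.
  by have := sqr_ge0 (Num.sqrt (node M k i) - Num.sqrt (node M k j)); rewrite -/C; lra.
- have H' : - ('X - bernstein_poly M Num.sqrt k ^+ 2) =
    bernstein ('X * (M^-1)%:P) k.+1 (fun i => bernstein ('X * (M^-1)%:P) k.+1 (fun j =>
      (- (2^-1 * (Num.sqrt (node M k i) - Num.sqrt (node M k j)) ^+ 2))%:P)).
    rewrite bernstein_sqrt_square -mulN1r -bernsteinM; apply: eq_bernstein => i _.
    rewrite -bernsteinM; apply: eq_bernstein => j _.
    by rewrite mulN1r -polyCN.
  rewrite -['X - _]opprK H'; apply: cone_bernstein2_bound => // i j ik jl.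
  apply: (@le_trans _ _ 0); first by rewrite oppr_le0 mulr_ge0 ?sqr_ge0 ?invr_ge0.
  by rewrite addr_ge0 ?(ltW e2)// mulr_ge0 ?sqr_ge0.
Qed.

(** The square root is the limit [B] of the Bernstein polynomials of [sqrt] at
    [A].  These are positive since [sqrt >= 0], and their squares tend
    to [A]. *)
Lemma positive_sqrt_exists :
  exists B, [/\ bounded_op d B, positive_op d B & forall x, B (B x) = A x].
Proof.
have cs : {within `[0, +oo[, continuous (@Num.sqrt R)}.
  by apply: continuous_subspaceT => x; exact: sqrt_continuous.
have [B [bB cB]] := bernstein_polyop_converges _ cs.
exists B; split=> //.
- move=> x.
  have h e : 0 < e -> exists2 w : R[i], 0 <= w & complex.Re `|d (B x) x - w| <= e.
    move=> e0; have e1 : 0 < e / (N x ^+ 2 + 1) by rewrite divr_gt0// ltr_wpDl ?sqr_ge0.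
    have [n hn] := cB _ e1; exists (d (polyop A (bernstein_poly M Num.sqrt n) x) x).
      apply: positive_opP; first exact: symmetric_polyop bA.1 sA.
      apply: (cone_polyop_ge0 M d A _ bA.1 sA hA').
      by apply: cone_bernstein => // j jk; apply: cone_const; rewrite sqrtr_ge0.
    rewrite -linearBl /=; apply: le_trans (dot_le_hnorm _ _ _) _.
    rewrite hnorm_distC; apply: (@le_trans _ _ (e / (N x ^+ 2 + 1) * N x * N x)).
      by rewrite ler_wpM2r ?hnorm_ge0 ?hn.
    rewrite -mulrA -expr2 mulrAC ler_pdivrMr ?ltr_wpDl ?sqr_ge0//.
    by rewrite ler_wpM2l ?(ltW e0)// lerDl.
  move: (d (B x) x) h => z h; rewrite lecE /=; apply/andP; split.
    rewrite -normr_le0; apply/ler_addgt0Pr => e e0; rewrite add0r.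
    have [w w0 hw] := h _ e0; apply: le_trans (hw).
    have -> : complex.Im z = complex.Im (z - w); last exact: im_le_norm.
    move: w0; rewrite lecE /= => /andP[/eqP w0 _].
    by case: z w w0 {h hw} => a b [a' b'] /= ->; rewrite subr0.
  apply/ler_addgt0Pr => e e0.
  have [w w0 hw] := h _ e0; move: w0; rewrite lecE /= => /andP[_ w0].
  have := le_trans (re_le_norm (w - z)) (_ : complex.Re `|w - z| <= e).
  rewrite distrC => /(_ hw).
  by case: z w {h hw} w0 => a b [a' b'] /=; lra.
- move=> x; apply/eqP; rewrite -subr_eq0 -(hnorm_eq0 d) eq_le hnorm_ge0 andbT.
  apply/ler_addgt0Pr => e e0; rewrite add0r.
  have [K K0 hK] := bounded_op_ge0 _ _ bB.
  have k0 : 0 < (2 * K + 2) * N x + 1.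
    by rewrite ltr_wpDl// mulr_ge0 ?hnorm_ge0// addr_ge0// mulr_ge0.
  (* [e' <= 1] keeps [|P x|] below [(1 + K) |x|]. *)
  pose e' := Num.min 1 (e / ((2 * K + 2) * N x + 1)).
  have e'0 : 0 < e' by rewrite lt_min ltr01 divr_gt0.
  have [n1 h1] := cB _ e'0; have [n2 h2] := bernstein_sqrt_polyop _ e'0.
  have {}h1 := h1 (maxn n1 n2) (leq_maxl _ _); have {}h2 := h2 (maxn n1 n2) (leq_maxr _ _) x.
  move: h1 h2; set p := bernstein_poly _ _ _ => h1; rewrite expr2 (polyopM _ _ _ _ bA.1) => h2.
  set P := polyop A p in h1 h2.
  have t1 := hnorm_triangle d (B (B x)) (B (P x)) (A x).
  have t2 := hnorm_triangle d (B (P x)) (P (P x)) (A x).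
  have t3 : N (B (B x) - B (P x)) <= K * (e' * N x).
    rewrite -(linopB _ bB.1); apply: le_trans (hK _) _.
    by rewrite ler_wpM2l// hnorm_distC.
  have t4 : N (B (P x) - P (P x)) <= e' * N (P x) by rewrite hnorm_distC.
  have t5 : N (P x) <= (1 + K) * N x.
    rewrite -[P x](subrK (B x)) (le_trans (hnormD _ _ _))// mulrDl lerD//.
    by apply: le_trans (h1 x) _; rewrite ler_wpM2r ?hnorm_ge0// ge_min lexx.
  have t6 : e' * ((2 * K + 2) * N x) <= e.
    apply: (@le_trans _ _ (e / ((2 * K + 2) * N x + 1) * ((2 * K + 2) * N x + 1))).
      rewrite ler_pM ?(ltW e'0) ?lerDl//.
        by rewrite mulr_ge0 ?hnorm_ge0// addr_ge0// mulr_ge0.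
      by rewrite ge_min lexx orbT.
    by rewrite divfK ?gt_eqF.
  have t7 : e' * N (P x) <= e' * ((1 + K) * N x) by rewrite ler_wpM2l ?(ltW e'0).
  rewrite hnorm_distC in h2.
  by lra.
Qed.

End FunctionalCalculus.
End Limits.

(** * Absolute values and approximate eigenvalues *)

Section AbsoluteValue.
Context {R : realType} {V : lmodType R[i]}.
Variable d : {dot V for conjC}.
Hypothesis cV : hcomplete d.
Implicit Types (A B P : V -> V) (x y : V).

Local Notation re x y := (complex.Re (d x y)).
Local Notation N := (hnorm d).

Lemma re_op_le A x : bounded_op d A -> re (A x) x <= (opnorm d A + 1) * N x ^+ 2.
Proof.
move=> bA; apply: le_trans (re_le_hnorm _ _ _) _.
rewrite expr2 mulrA ler_wpM2r ?hnorm_ge0//.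
apply: le_trans (hnorm_le_opnorm _ _ _ bA) _.
by rewrite ler_wpM2r ?hnorm_ge0// lerDl.
Qed.

Lemma opnormS_gt0 A : bounded_op d A -> 0 < opnorm d A + 1.
Proof. by move=> bA; rewrite ltr_wpDl// opnorm_ge0. Qed.

Lemma absop_spec A : bounded_op d A ->
  [/\ bounded_op d (absop d A), positive_op d (absop d A)
    & forall x, absop d A (absop d A x) = adjoint d A (A x)].
Proof.
move=> bA; apply: (@xgetPex _ (fun=> 0) [set B | [/\ bounded_op d B,
  positive_op d B & forall x, B (B x) = adjoint d A (A x)]]).
have bAA : bounded_op d (fun x => adjoint d A (A x)).
  by apply: bounded_op_comp => //; exact: bounded_adjoint.
apply: (positive_sqrt_exists d cV _ _ (opnormS_gt0 _ bAA) bAA).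
  apply: positive_opP; last by move=> x; rewrite -hnorm_opE// sqr_ge0.
  by move=> x y; rewrite -adjointE// dotC -adjointE// -dotC.
by move=> x; exact: (re_op_le _ x bAA).
Qed.

Lemma hnorm_absop A x : bounded_op d A -> N (absop d A x) = N (A x).
Proof.
move=> bA; have [bB pB BB] := absop_spec _ bA.
have sB := positive_symmetric _ _ bB.1 pB.
apply/eqP; rewrite -(@eqrXn2 _ 2%N) ?hnorm_ge0// (hnorm_opE _ cV A _ bA) -BB.
by rewrite symmetric_re// -hnorm_sqr.
Qed.

Lemma opnorm_absop A : bounded_op d A -> opnorm d (absop d A) = opnorm d A.
Proof.
move=> bA; rewrite /opnorm; congr (sup _).
by apply: eq_imagel => x _; exact: hnorm_absop.
Qed.

Lemma cfc_spec A (f : R -> R) : bounded_op d A -> positive_op d A ->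
  {within `[0, +oo[, continuous f} -> is_cfc d A f (cfc d A f).
Proof.
move=> bA pA cf; apply: (@xgetPex _ (fun=> 0) [set B | is_cfc d A f B]).
apply: (is_cfc_exists d cV A _ (opnormS_gt0 _ bA) bA pA) cf.
by move=> x; exact: re_op_le.
Qed.

Definition approx_eigenvalue A (a : R) : Prop :=
  forall e : R, 0 < e -> exists x, 0 < N x /\ N (A x - a%:C *: x) <= e * N x.

Lemma approx_eigenvalue_spectrum A a :
  approx_eigenvalue A a -> spectrum d A a%:C.
Proof.
move=> hA [B [bB h1 _]]; have [K K0 hK] := bounded_op_ge0 _ _ bB.
have e0 : 0 < (K + 1)^-1 by rewrite invr_gt0 ltr_wpDl.
have [x [x0 hx]] := hA _ e0; have := hK (A x - a%:C *: x); rewrite h1 => h.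
have : K * N (A x - a%:C *: x) <= K * ((K + 1)^-1 * N x) by rewrite ler_wpM2l.
have h2 : (K + 1)^-1 * (K + 1) = 1 by rewrite mulVf// gt_eqF// ltr_wpDl.
move=> h3; have : (K + 1)^-1 * N x <= 0 by nra.
by rewrite leNgt mulr_gt0.
Qed.

Lemma approx_eigenvalue_le_opnorm A a : bounded_op d A ->
  approx_eigenvalue A a -> a <= opnorm d A.
Proof.
move=> bA hA; apply/ler_addgt0Pr => e e0; have [x [x0 hx]] := hA _ e0.
rewrite -(ler_pM2r x0); apply: (@le_trans _ _ (`|a| * N x)).
  by rewrite ler_wpM2r ?hnorm_ge0// ler_norm.
rewrite -hnormZr; have := hnorm_le_opnorm _ A x bA.
have := hnormB d (A x) (A x - a%:C *: x).
by rewrite opprB addrC subrK; nra.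
Qed.

(** [p - p(a)] is divisible by [X - a], so [p(A) - p(a)] is a bounded operator
    applied after [A - a]. *)
Lemma approx_eigenvalue_poly A p a : bounded_op d A ->
  approx_eigenvalue A a -> approx_eigenvalue (polyop A p) p.[a].
Proof.
move=> bA hA.
have /factor_theorem[q hq] : root (p - p.[a]%:P) a.
  by rewrite /root hornerD hornerN hornerC subrr.
have bq := bounded_polyop d A q bA; have [K K0 hK] := bounded_op_ge0 _ _ bq.
move=> e e0; have k0 : 0 < K + 1 by rewrite ltr_wpDl.
have e1 : 0 < e / (K + 1) by rewrite divr_gt0.
have [x [x0 hx]] := hA _ e1; exists x; split => //.
rewrite -(polyopC A) -polyopB hq polyopM ?bA.1//; last exact: bA.1.
rewrite polyopB polyopX polyopC; apply: le_trans (hK _) _.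
apply: (@le_trans _ _ ((K + 1) * (e / (K + 1) * N x))).
  by rewrite ler_pM ?hnorm_ge0// lerDl.
by rewrite mulrA mulrCA divff ?gt_eqF// mulr1.
Qed.

Lemma approx_eigenvalue_sqr A a : bounded_op d A ->
  approx_eigenvalue A a -> approx_eigenvalue (A \o A) (a ^+ 2).
Proof.
move=> bA /(approx_eigenvalue_poly _ 'X^2 _ bA); rewrite hornerXn.
rewrite (_ : polyop A 'X^2 = A \o A)//; apply/funext => x.
by rewrite polyopMX polyopX.
Qed.

(** Approximate eigenvalues are in the spectrum, so the polynomials defining
    [f(A)] converge to [f a] there, while they converge to [f(A)] in norm. *)
Lemma approx_eigenvalue_cfc A f C a : bounded_op d A -> is_cfc d A f C ->
  approx_eigenvalue A a -> approx_eigenvalue C (f a).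
Proof.
move=> bA [bC [p [hp /cvgrPdist_le cp]]] hA e e0.
have e3 : 0 < e / 3 by rewrite divr_gt0.
have [n1 _ h1] := hp _ e3; have [n2 _ h2] := cp _ e3.
pose k := maxn n1 n2.
have {}h1 := h1 k (leq_maxl _ _) _ (approx_eigenvalue_spectrum _ _ hA).
have := h2 k (leq_maxr _ _); rewrite sub0r normrN => {}h2.
have [x [x0 hx]] := approx_eigenvalue_poly _ (p k) _ bA hA _ e3.
exists x; split=> //.
have bP := bounded_opB _ _ _ (bounded_polyop d A (p k) bA) bC.
have h3 : N (polyop A (p k) x - C x) <= e / 3 * N x.
  apply: le_trans (hnorm_le_opnorm _ _ x bP) _.
  by rewrite ler_wpM2r ?hnorm_ge0// (le_trans (ler_norm _)).
have h4 : N ((p k).[a]%:C *: x - (f a)%:C *: x) <= e / 3 * N x.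
  by rewrite -scalerBl -rmorphB hnormZr ler_wpM2r ?hnorm_ge0 ?(ltW h1).
have t1 := hnorm_triangle d (C x) (polyop A (p k) x) ((f a)%:C *: x).
have t2 := hnorm_triangle d (polyop A (p k) x) ((p k).[a]%:C *: x) ((f a)%:C *: x).
by rewrite hnorm_distC in h3; lra.
Qed.

(** If [|Ax|] is almost [l = |A|], then [(A^2 - l^2) x] is small, because
    [|A^2 x|^2 - 2 l^2 |Ax|^2 + l^4 |x|^2] is.  Writing it as [(A + l) y] with
    [y = (A - l) x] and using [<(A + l) y, y> >= l |y|^2] shows that [y] is
    small. *)
Lemma opnorm_approx_eigenvalue A : bounded_op d A -> positive_op d A ->
  0 < opnorm d A -> approx_eigenvalue A (opnorm d A).
Proof.
move=> bA pA; set l := opnorm d A => l0 e e0.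
have sA := positive_symmetric _ _ bA.1 pA.
(* [t <= l / 2] forces [|x| >= 1/2]; the other bound gives
   [2 l t <= (e / 2)^2], the square of the estimate for [y]. *)
pose t := Num.min (l / 2) (e ^+ 2 / (8 * l)).
have t0 : 0 < t by rewrite lt_min !divr_gt0 ?exprn_gt0 ?mulr_gt0.
have t1 : t <= l / 2 by rewrite ge_min lexx.
have t2 : 8 * l * t <= e ^+ 2.
  by rewrite mulrC -ler_pdivlMr ?mulr_gt0// ge_min lexx orbT.
have hs : has_sup [set N (A x) | x in [set x | N x <= 1]].
  split; last exact: opnorm_ubound.
  by exists (N (A 0)), 0 => //=; rewrite hnorm0.
have [_ [x /= x1 <-]] := sup_adherent t0 hs; rewrite -/(opnorm d A) -/l => hx.
have hAx : N (A x) <= l * N x by exact: hnorm_le_opnorm.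
have hAAx : N (A (A x)) <= l * N (A x) by exact: hnorm_le_opnorm.
have x2 : 1 / 2 <= N x by rewrite -(ler_pM2l l0); lra.
exists x; split; first by lra.
pose y := A x - l%:C *: x; rewrite -/y.
pose z := A y + l%:C *: y.
have ez : z = A (A x) - (l ^+ 2)%:C *: x.
  rewrite /z /y (linopB _ bA.1) (linopZ _ bA.1) scalerBr scalerA -rmorphM -expr2.
  by rewrite addrA subrK.
have hz : N z ^+ 2 <= 2 * l ^+ 3 * t.
  rewrite ez hnormB_sqr reZr symmetric_re// -hnorm_sqr hnormZr.
  rewrite ger0_norm ?exprn_ge0 ?(ltW l0)//.
  have h1 : N (A (A x)) ^+ 2 <= l ^+ 2 * N (A x) ^+ 2.
    by rewrite -exprMn ler_pXn2r ?nnegrE ?mulr_ge0 ?hnorm_ge0 ?(ltW l0).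
  have h2 : (l ^+ 2 * N x) ^+ 2 <= l ^+ 2 * l ^+ 2.
    rewrite exprMn -[leRHS]mulr1 -expr2 ler_wpM2l ?exprn_ge0 ?(ltW l0)//.
    by rewrite -(expr1n _ 2) ler_pXn2r ?nnegrE ?hnorm_ge0.
  have h3 : (l - t) ^+ 2 <= N (A x) ^+ 2.
    by rewrite ler_pXn2r ?nnegrE ?hnorm_ge0 ?(ltW hx)//; lra.
  have h4 : l ^+ 2 * (l - t) ^+ 2 <= l ^+ 2 * N (A x) ^+ 2.
    by rewrite ler_wpM2l ?exprn_ge0 ?(ltW l0).
  have h5 : 0 <= l ^+ 2 * t ^+ 2 by rewrite mulr_ge0 ?sqr_ge0.
  have -> : 2 * l ^+ 3 * t = l ^+ 2 * l ^+ 2 - l ^+ 2 * (l - t) ^+ 2 + l ^+ 2 * t ^+ 2 by ring.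
  by move: h1 h2 h4; rewrite exprMn; lra.
have hyz : l * N y <= N z.
  have [->|ne] := eqVneq (N y) 0; first by rewrite mulr0 hnorm_ge0.
  have p0 : 0 < N y by rewrite lt_def ne hnorm_ge0.
  rewrite -(ler_pM2r p0); apply: le_trans (re_le_hnorm _ _ _).
  rewrite /z reDl reZl -hnorm_sqr -mulrA -expr2 lerDr.
  exact: positive_re.
have h2 : (l * N y) ^+ 2 <= 2 * l ^+ 3 * t.
  by apply: le_trans hz; rewrite ler_pXn2r ?nnegrE ?mulr_ge0 ?hnorm_ge0 ?(ltW l0).
have h3 : N y ^+ 2 <= (e / 2) ^+ 2.
  rewrite -(ler_pM2l (exprn_gt0 2 l0)) -exprMn; apply: le_trans h2 _.
  have -> : 2 * l ^+ 3 * t = l ^+ 2 * (8 * l * t) / 4 by field.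
  have -> : l ^+ 2 * (e / 2) ^+ 2 = l ^+ 2 * e ^+ 2 / 4 by field.
  by rewrite ler_wpM2r ?invr_ge0// ler_wpM2l ?exprn_ge0 ?(ltW l0).
have h4 : N y <= e / 2.
  by move: h3; rewrite ler_pXn2r ?nnegrE ?hnorm_ge0// divr_ge0 ?(ltW e0).
by apply: le_trans h4 _; rewrite ler_wpM2l ?(ltW e0)//; lra.
Qed.

Lemma cfc_sq_opnorm A (f : R -> R) : bounded_op d A -> positive_op d A ->
  {within `[0, +oo[, continuous f} -> 0 < opnorm d A ->
  f (opnorm d A) ^+ 2 <= opnorm d (cfc_sq d A f).
Proof.
move=> bA pA cf l0; have hC := cfc_spec _ _ bA pA cf.
apply: approx_eigenvalue_le_opnorm; first exact: bounded_op_comp hC.1 hC.1.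
apply: approx_eigenvalue_sqr; first exact: hC.1.
apply: (approx_eigenvalue_cfc _ _ _ _ bA hC).
exact: (opnorm_approx_eigenvalue A bA pA l0).
Qed.

(** [|T|] and [|T*|] both have norm [l = |T|], so the two factors are at least
    [f l] and [g l].  For [T = 0] there is no approximate eigenvector, but
    nothing to prove. *)
Lemma opnorm_le_cfc_sq (f g : R -> R) T :
  {within `[0, +oo[, continuous f} -> {within `[0, +oo[, continuous g} ->
  (forall t : R, 0 <= t -> 0 <= f t) -> (forall t : R, 0 <= t -> 0 <= g t) ->
  (forall t : R, 0 <= t -> f t * g t = t) -> bounded_op d T ->
  opnorm d T <= Num.sqrt (opnorm d (cfc_sq d (absop d T) f)) *
                Num.sqrt (opnorm d (cfc_sq d (absop d (adjoint d T)) g)).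
Proof.
move=> cf cg f0 g0 fg bT; have bT' := bounded_adjoint _ cV _ bT.
have := opnorm_ge0 _ _ bT; rewrite le_eqVlt => /orP[/eqP <-|l0].
  by rewrite mulr_ge0 ?sqrtr_ge0.
have [bB pB _] := absop_spec _ bT; have [bB' pB' _] := absop_spec _ bT'.
have l1 := opnorm_absop _ bT.
have l2 : opnorm d (absop d (adjoint d T)) = opnorm d T.
  by rewrite opnorm_absop// opnorm_adjoint.
have h1 := cfc_sq_opnorm _ _ bB pB cf; rewrite l1 in h1.
have h2 := cfc_sq_opnorm _ _ bB' pB' cg; rewrite l2 in h2.
have lw := ltW l0.
rewrite -{1}(fg _ lw) ler_pM ?f0 ?g0//.
  by rewrite -(ger0_norm (f0 _ lw)) -sqrtr_sqr ler_wsqrtr// h1.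
by rewrite -(ger0_norm (g0 _ lw)) -sqrtr_sqr ler_wsqrtr// h2.
Qed.

End AbsoluteValue.

(** * Completeness of H and of C^n *)

Lemma cauchy_seq_converges {K : numFieldType} {W : completeNormedModType K} (u : nat -> W) :
  (forall e : K, 0 < e -> exists n, forall k, (n <= k)%N -> `|u n - u k| < e) ->
  exists z, forall e : K, 0 < e -> exists n, forall k, (n <= k)%N -> `|z - u k| <= e.
Proof.
move=> cu; have : cauchy (u @ \oo).
  apply: cauchy_exP => e e0; have [n hn] := cu _ e0; exists (u n).
  by exists n => // k /= nk; rewrite -ball_normE /=; exact: hn.
move=> /cauchy_cvgP /cvgrPdist_le h; exists (lim (u @ \oo)) => e e0.
by have [n _ hn] := h _ e0; exists n => k nk; exact: hn.
Qed.

Lemma real_cauchy_converges {R : realType} (u : nat -> R) :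
  (forall e : R, 0 < e -> exists m, forall k l, (m <= k)%N -> (m <= l)%N ->
    `|u k - u l| <= e) ->
  exists z, forall e : R, 0 < e -> exists m, forall k, (m <= k)%N -> `|u k - z| <= e.
Proof.
move=> cu; have [z hz] : exists z : R^o, forall e : R, 0 < e ->
    exists n, forall k, (n <= k)%N -> `|z - (u : nat -> R^o) k| <= e.
  apply: cauchy_seq_converges => e e0.
  have e1 : 0 < e / 2 by rewrite divr_gt0.
  have [m hm] := cu _ e1; exists m => k mk.
  by apply: le_lt_trans (hm _ _ (leqnn m) mk) _; lra.
exists z => e e0; have [m hm] := hz _ e0; exists m => k mk.
by rewrite distrC; exact: hm.
Qed.

Lemma hcomplete_inner {R : realType} (H : completeNormedModType R[i])
  (d : {dot H for conjC}) : is_inner d -> hcomplete d.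
Proof.
move=> hd; have normE x : `|x| = (hnorm d x)%:C.
  apply/eqP; rewrite -(@eqrXn2 _ 2%N) ?ler0c ?hnorm_ge0// hd -rmorphXn /=.
  by rewrite hnorm_sqr -dot_self_real.
move=> u cu; have [z hz] : exists z, forall e : R[i], 0 < e ->
    exists n, forall k, (n <= k)%N -> `|z - u k| <= e.
  apply: cauchy_seq_converges => e e0.
  have e1 : 0 < complex.Re e / 2 by move: e0; rewrite ltcE /= => /andP[_ h]; rewrite divr_gt0.
  have [n hn] := cu _ e1; exists n => k nk; rewrite normE.
  have := hn n k (leqnn n) nk => h; move: e0; rewrite !ltcE /= => /andP[-> h'] /=; lra.
exists z => e e0; have [|n hn] := hz e%:C; first by rewrite ltcR.
by exists n => k nk; rewrite hnorm_distC -lecR -normE; exact: hn.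
Qed.

Section EuclideanSpace.
Context {R : realType} {n : nat}.
Implicit Types (x y : 'cV[R[i]]_n) (A B : 'M[R]_n).
Local Notation cdot := (@cdot R n).
Local Notation N := (hnorm cdot).

Lemma cdotE x y : cdot x y = \sum_i x i 0 * ((y i 0)^*)%C.
Proof.
rewrite /Defs.cdot dotmxE mxE; apply: eq_bigr => i _.
by rewrite !mxE.
Qed.

Lemma cdot_delta x i : cdot x (delta_mx i 0) = x i 0.
Proof.
rewrite cdotE (bigD1 i)//= big1 => [|j ji]; rewrite !mxE ?eqxx /=.
  by rewrite oppr0 mulr1 addr0.
by rewrite (negPf ji) conjc_nat mulr0.
Qed.

Lemma hnorm_delta i : N (delta_mx i 0) = 1.
Proof.
rewrite -[LHS]/(Num.sqrt (complex.Re (cdot (delta_mx i 0) (delta_mx i 0)))).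
by rewrite cdot_delta mxE !eqxx /= sqrtr1.
Qed.

Lemma coord_le_hnorm x i : complex.Re `|x i 0| <= N x.
Proof. by rewrite -cdot_delta -[leRHS]mulr1 -(hnorm_delta i); exact: dot_le_hnorm. Qed.

Lemma hnorm_le_sum x : N x <= \sum_i complex.Re `|x i 0|.
Proof.
have -> : x = \sum_i x i 0 *: delta_mx i 0.
  apply/matrixP => i j; rewrite ord1 summxE (bigD1 i)//= big1 => [|k ki].
    by rewrite !mxE !eqxx mulr1 addr0.
  by rewrite !mxE eq_sym (negPf ki) mulr0.
apply: (big_ind2 (fun (v : 'cV[R[i]]_n) (r : R) => N v <= r)).
- by rewrite hnorm0.
- by move=> v r v' r' h h'; apply: le_trans (hnormD _ _ _) _; exact: lerD.
- move=> i _; rewrite hnormZ hnorm_delta mulr1 summxE (bigD1 i)//= big1 => [|k ki].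
    by rewrite !mxE !eqxx mulr1 addr0.
  by rewrite !mxE eq_sym (negPf ki) mulr0.
Qed.

Lemma hcomplete_cdot : hcomplete cdot.
Proof.
move=> u cu.
have /choice[z hz] : forall i : 'I_n, exists z : R[i], forall e : R, 0 < e ->
    exists m, forall k, (m <= k)%N -> complex.Re `|u k i 0 - z| <= e.
  move=> i.
  have cau k l : complex.Re `|u k i 0 - u l i 0| <= N (u k - u l).
    by apply: le_trans (coord_le_hnorm _ i); rewrite !mxE.
  have [a ha] : exists a, forall e : R, 0 < e ->
      exists m, forall k, (m <= k)%N -> `|complex.Re (u k i 0) - a| <= e.
    apply: real_cauchy_converges => e e0; have [m hm] := cu _ e0.
    exists m => k l mk ml; apply: le_trans (hm _ _ mk ml); apply: le_trans (cau k l).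
    by rewrite -re_sub; exact: re_norm_ge.
  have [b hb] : exists b, forall e : R, 0 < e ->
      exists m, forall k, (m <= k)%N -> `|complex.Im (u k i 0) - b| <= e.
    apply: real_cauchy_converges => e e0; have [m hm] := cu _ e0.
    exists m => k l mk ml; apply: le_trans (hm _ _ mk ml); apply: le_trans (cau k l).
    by rewrite -im_sub; exact: im_le_norm.
  exists (a +i* b) => e e0; have e2 : 0 < e / 2 by rewrite divr_gt0.
  have [m1 h1] := ha _ e2; have [m2 h2] := hb _ e2; exists (maxn m1 m2) => k.
  rewrite geq_max => /andP[/h1 {}h1 /h2 {}h2]; apply: le_trans (Re_norm_le _) _.
  by case: (u k i 0) h1 h2 => ? ? /=; lra.
exists (\col_i z i) => e e0.
have e1 : 0 < e / n.+1%:R by rewrite divr_gt0.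
have /choice[m hm] : forall i : 'I_n, exists m, forall k, (m <= k)%N ->
    complex.Re `|u k i 0 - z i| <= e / n.+1%:R by move=> i; exact: hz.
exists (\max_i m i) => k mk; apply: le_trans (hnorm_le_sum _) _.
apply: (@le_trans _ _ (\sum_(i < n) e / n.+1%:R)).
  apply: ler_sum => i _; rewrite !mxE; apply: hm.
  by apply: leq_trans mk; exact: leq_bigmax.
rewrite sumr_const card_ord -(mulr_natr (e / _)) -mulrA -[leRHS]mulr1 ler_wpM2l ?(ltW e0)//.
by rewrite mulrC ler_pdivrMr// mul1r ler_nat.
Qed.

Lemma mxopE A x i : mxop A x i 0 = \sum_j (A i j)%:C * x j 0.
Proof. by rewrite mxE; apply: eq_bigr => j _; rewrite mxE. Qed.

Lemma cdot_mxop A x y : cdot (mxop A x) y = cdot x (mxop A^T y).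
Proof.
rewrite !cdotE; under eq_bigr do rewrite mxopE mulr_suml.
rewrite exchange_big /=; apply: eq_bigr => j _.
rewrite mxopE rmorph_sum mulr_sumr; apply: eq_bigr => i _ /=.
by rewrite rmorphM /= mxE oppr0 mulrA [x j 0 * _]mulrC.
Qed.

Lemma bounded_mxop A : bounded_op cdot (mxop A).
Proof.
split=> [a x y|]; first by rewrite /mxop mulmxDr -scalemxAr.
exists (\sum_i \sum_j `|A i j|) => x; apply: le_trans (hnorm_le_sum _) _.
rewrite mulr_suml; apply: ler_sum => i _; rewrite mulr_suml mxopE.
apply: (big_ind2 (fun (v : R[i]) (r : R) => complex.Re `|v| <= r)).
- by rewrite normr0.
- by move=> v r v' r' h h'; apply: le_trans (Re_normD _ _) _; exact: lerD.
- by move=> j _; rewrite Re_norm_realM ler_wpM2l ?coord_le_hnorm.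
Qed.

End EuclideanSpace.

(** * Numerical radii and mixtures of squares *)

Lemma sup_le_ge0 {R : realType} (E : set R) (m : R) :
  (forall x, E x -> x <= m) -> 0 <= m -> sup E <= m.
Proof.
move=> h m0; have [[x Ex]|/set0P/negP] := pselect (E !=set0).
  by apply: ge_sup; [exists x|exact: h].
by rewrite negbK => /eqP ->; rewrite sup0.
Qed.

Section SelfAdjointNorm.
Context {R : realType} {V : lmodType R[i]}.
Variable d : {dot V for conjC}.
Local Notation re x y := (complex.Re (d x y)).
Local Notation N := (hnorm d).

(** Polarization of [4 re (A x) y] with [y] the multiple of [A x] of the same
    norm as [x]. *)
Lemma symmetric_norm_le (A : V -> V) (c : R) : linear A -> symmetric_op d A ->
  (forall x, `|re (A x) x| <= c * N x ^+ 2) -> 0 <= c ->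
  forall x, N (A x) <= c * N x.
Proof.
move=> lA sA h c0 x.
have [->|ne] := eqVneq (N (A x)) 0; first by rewrite mulr_ge0 ?hnorm_ge0.
have p0 : 0 < N (A x) by rewrite lt_def ne hnorm_ge0.
have [/eqP|nx] := eqVneq (N x) 0.
  by rewrite hnorm_eq0 => /eqP x0; rewrite x0 (linop0 _ lA) hnorm0 mulr0.
have px : 0 < N x by rewrite lt_def nx hnorm_ge0.
pose y := (N x / N (A x))%:C *: A x.
have Ny : N y = N x by rewrite hnormZr ger0_norm ?divr_ge0 ?hnorm_ge0// divfK.
have rAy : re (A x) y = N x * N (A x).
  by rewrite reZr -hnorm_sqr; field.
have h1 := le_trans (ler_norm _) (h (x + y)).
have h2 := le_trans (ler_norm _) (h (x - y)); have h2' := h (x - y).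
rewrite ler_norml in h2'; case/andP: h2' => h3 _.
have pol : re (A (x + y)) (x + y) - re (A (x - y)) (x - y) = 4 * re (A x) y.
  rewrite linopD// linopB// !(reDl, reDr, reNl, reNr) (symmetric_re _ _ y x sA).
  by rewrite (reC d y (A x)); ring.
have sum2 : N (x + y) ^+ 2 + N (x - y) ^+ 2 = 2 * N x ^+ 2 + 2 * N y ^+ 2.
  by rewrite !hnorm_sqr !(reDl, reDr, reNl, reNr); ring.
rewrite -(ler_pM2l px) -rAy.
have h4 : c * N (x + y) ^+ 2 + c * N (x - y) ^+ 2 = 4 * (N x * (c * N x)).
  by rewrite -mulrDr sum2 Ny; ring.
lra.
Qed.

Lemma dot_le_numradius (A : V -> V) x : bounded_op d A ->
  complex.Re `|d (A x) x| <= numradius d A * N x ^+ 2.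
Proof.
move=> bA; have [M M0 hM] := bounded_op_ge0 _ _ bA.
have ub : has_ubound [set complex.Re `|d (A x) x| | x in [set x | N x = 1]].
  exists M => _ [y /= y1 <-]; apply: le_trans (dot_le_hnorm _ _ _) _.
  by have := hM y; rewrite y1 !mulr1.
have [/eqP|nx] := eqVneq (N x) 0.
  by rewrite hnorm_eq0 => /eqP ->; rewrite linear0r normr0 hnorm0 expr0n mulr0.
have px : 0 < N x by rewrite lt_def nx hnorm_ge0.
pose y := (N x)^-1%:C *: x.
have y1 : N y = 1 by rewrite hnormZr ger0_norm ?invr_ge0 ?hnorm_ge0// mulVf.
have xy : x = (N x)%:C *: y by rewrite scalerA -rmorphM /= divff// scale1r.
have hy : complex.Re `|d (A y) y| <= numradius d A.
  by apply: ub_le_sup => //; exists y.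
have -> : d (A x) x = (N x)%:C * ((N x)%:C * d (A y) y).
  by rewrite {1 2}xy (linopZ _ bA.1) linearZl_LR linearZr_LR /= conjC_real.
rewrite !Re_norm_realM ger0_norm ?hnorm_ge0// mulrA mulrC -expr2.
by rewrite ler_wpM2r ?sqr_ge0.
Qed.

Lemma numradius_ge0 (A : V -> V) : bounded_op d A -> 0 <= numradius d A.
Proof.
move=> bA; have [[x x1]|h] := pselect (exists x, N x = 1); last first.
  rewrite /numradius (_ : [set _ | _ in _] = set0) ?sup0//.
  by apply/seteqP; split => // r [x x1 _]; apply: h; exists x.
have := dot_le_numradius A x bA; rewrite x1 expr1n mulr1; apply: le_trans.
by apply: le_trans (re_norm_ge _); exact: normr_ge0.
Qed.

Section MixedSquares.
Hypothesis cV : hcomplete d.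
Variables A B : V -> V.
Hypotheses (bA : bounded_op d A) (bB : bounded_op d B).

Definition mixed_squares (a : R) : V -> V := fun x =>
  a%:C *: absop d A (absop d A x) + (1 - a)%:C *: absop d B (absop d B x).

Let bAA : bounded_op d (fun x => absop d A (absop d A x)).
Proof. by apply: bounded_op_comp; have [] := absop_spec _ cV _ bA. Qed.

Let bBB : bounded_op d (fun x => absop d B (absop d B x)).
Proof. by apply: bounded_op_comp; have [] := absop_spec _ cV _ bB. Qed.

Lemma bounded_mixed_squares a : bounded_op d (mixed_squares a).
Proof. by apply: bounded_opD; exact: bounded_opZ. Qed.

Lemma re_mixed_squares a x :
  re (mixed_squares a x) x = a * N (A x) ^+ 2 + (1 - a) * N (B x) ^+ 2.
Proof.
rewrite /mixed_squares reDl !reZl; have [_ _ ->] := absop_spec _ cV _ bA.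
by have [_ _ ->] := absop_spec _ cV _ bB; rewrite -!hnorm_opE.
Qed.

Lemma mixed_squares_le_opnorm a x :
  a * N (A x) ^+ 2 + (1 - a) * N (B x) ^+ 2 <= opnorm d (mixed_squares a) * N x ^+ 2.
Proof.
rewrite -re_mixed_squares; apply: le_trans (re_le_hnorm _ _ _) _.
rewrite expr2 mulrA ler_wpM2r ?hnorm_ge0//.
exact: hnorm_le_opnorm (bounded_mixed_squares a).
Qed.

Lemma le_mixed_squares a v x : 0 <= a <= 1 -> N x = 1 ->
  0 <= v -> v <= N (A x) -> v <= N (B x) ->
  v <= Num.sqrt (opnorm d (mixed_squares a)).
Proof.
move=> /andP[a0 a1] x1 v0 vA vB.
rewrite -(ger0_norm v0) -sqrtr_sqr ler_wsqrtr//.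
have vA2 : v ^+ 2 <= N (A x) ^+ 2 by rewrite ler_pXn2r ?nnegrE ?hnorm_ge0.
have vB2 : v ^+ 2 <= N (B x) ^+ 2 by rewrite ler_pXn2r ?nnegrE ?hnorm_ge0.
have := mixed_squares_le_opnorm a x; rewrite x1 expr1n mulr1.
by apply: le_trans; nra.
Qed.

Lemma mixed_squares_lipschitz : exists2 L : R, 0 <= L &
  forall a b, `|opnorm d (mixed_squares a) - opnorm d (mixed_squares b)| <= L * `|a - b|.
Proof.
have [K K0 hK] := bounded_op_ge0 _ _ bAA; have [K' K'0 hK'] := bounded_op_ge0 _ _ bBB.
exists (K + K'); first by rewrite addr_ge0.
have le1 a b : opnorm d (mixed_squares a) <=
    opnorm d (mixed_squares b) + (K + K') * `|a - b|.
  apply: opnorm_le => [x|]; last first.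
    by rewrite addr_ge0 ?mulr_ge0 ?addr_ge0 ?opnorm_ge0//; exact: bounded_mixed_squares.
  have -> : mixed_squares a x = mixed_squares b x +
     ((a - b)%:C *: absop d A (absop d A x) + (b - a)%:C *: absop d B (absop d B x)).
    rewrite /mixed_squares addrACA -!scalerDl -!rmorphD.
    by congr (_%:C *: _ + _%:C *: _); ring.
  apply: le_trans (hnormD _ _ _) _; rewrite mulrDl lerD//.
    exact: hnorm_le_opnorm (bounded_mixed_squares b).
  apply: le_trans (hnormD _ _ _) _; rewrite !hnormZr (distrC b a).
  by have := normr_ge0 (a - b); have := hK x; have := hK' x; nra.
by move=> a b; rewrite ler_distl lerBlDr le1 (distrC a b) le1.
Qed.

Lemma mixed_squares_min : exists2 c : R, 0 <= c <= 1 & forall a, 0 <= a <= 1 ->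
  Num.sqrt (opnorm d (mixed_squares c)) <= Num.sqrt (opnorm d (mixed_squares a)).
Proof.
have [L L0 hL] := mixed_squares_lipschitz.
have cont : continuous (fun a : R => opnorm d (mixed_squares a)).
  move=> a; apply/cvgrPdist_le => e e0.
  have e1 : 0 < e / (L + 1) by rewrite divr_gt0// ltr_wpDl.
  apply: filterS (nbhsx_ballx a _ e1) => b; rewrite /ball /= => ab.
  apply: le_trans (hL a b) _; rewrite ltr_pdivlMr ?ltr_wpDl// in ab.
  by have := normr_ge0 (a - b); nra.
have [c c01 hc] := @EVT_min R (fun a => opnorm d (mixed_squares a)) 0 1 ler01
  (continuous_subspaceT cont).
exists c; first by move: c01; rewrite in_itv.
by move=> a a01; rewrite ler_wsqrtr// hc// in_itv.
Qed.

Lemma mixed_squares1_le (w : R) : (forall x, N (A x) <= w * N x) -> 0 <= w ->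
  Num.sqrt (opnorm d (mixed_squares 1)) <= w.
Proof.
move=> hw w0; have [bC pC CC] := absop_spec _ cV _ bA.
rewrite -(ger0_norm w0) -sqrtr_sqr ler_wsqrtr//; apply: opnorm_le; last exact: sqr_ge0.
move=> x; rewrite /mixed_squares subrr scale0r addr0 scale1r.
apply: le_trans (_ : w * (w * N x) <= _); last by rewrite mulrA.
have hC y : N (absop d A y) <= w * N y by rewrite hnorm_absop.
by apply: le_trans (hC _) _; rewrite ler_wpM2l.
Qed.

End MixedSquares.
End SelfAdjointNorm.

(** * Comparison of an operator matrix with its matrix of norms *)

Lemma hnorm_dsum_sqr {R : realType} {H : lmodType R[i]} (d : {dot H for conjC}) n
  (x : {ffun 'I_n -> H}) : hnorm (@dsum_dot R H d n) x ^+ 2 = \sum_i hnorm d (x i) ^+ 2.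
Proof.
rewrite hnorm_sqr -[LHS]/(complex.Re (\sum_i d (x i) (x i))).
apply: (big_ind2 (fun (z : R[i]) (r : R) => complex.Re z = r)) => //.
  by move=> [? ?] ? [? ?] ? <- <-.
by move=> i _; rewrite hnorm_sqr.
Qed.

Section RealMatrices.
Context {R : realType} {n : nat}.
Implicit Types (A : 'M[R]_n) (x : 'cV[R[i]]_n).
Local Notation cdot := (@cdot R n).

Lemma re_cdot_mxop_tr A x :
  complex.Re (cdot (mxop A^T x) x) = complex.Re (cdot (mxop A x) x).
Proof. by rewrite cdot_mxop trmxK; exact: reC. Qed.

Lemma re_cdot_symmetric_part A x :
  complex.Re (cdot (mxop (2^-1 *: (A + A^T)) x) x) =
  complex.Re (cdot (mxop A x) x).
Proof.
have -> : mxop (2^-1 *: (A + A^T)) x = (2^-1)%:C *: (mxop A x + mxop A^T x).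
  by rewrite /mxop map_mxZ map_mxD -scalemxAl mulmxDl.
transitivity (2^-1 * (complex.Re (cdot (mxop A x) x) +
                      complex.Re (cdot (mxop A^T x) x))).
  by rewrite -(reDl (@Defs.cdot R n)); exact: (reZl (@Defs.cdot R n)).
have half (r : R) : 2^-1 * (r + r) = r by field.
by rewrite [X in _ * (_ + X)]re_cdot_mxop_tr; exact: half.
Qed.

Lemma symmetric_mxop_symmetric_part A :
  symmetric_op cdot (mxop (2^-1 *: (A + A^T))).
Proof.
have sym : (2^-1 *: (A + A^T))^T = 2^-1 *: (A + A^T).
  by apply/matrixP => i j; rewrite !mxE addrC.
by move=> x y; have := cdot_mxop (2^-1 *: (A + A^T)) x y; rewrite sym.
Qed.

Lemma re_cdot_symmetric_part_le A x :
  `|complex.Re (cdot (mxop (2^-1 *: (A + A^T)) x) x)| <=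
  numradius cdot (mxop A) * hnorm cdot x ^+ 2.
Proof.
rewrite re_cdot_symmetric_part; apply: le_trans (re_norm_ge _) _.
exact: (dot_le_numradius cdot _ x (bounded_mxop A)).
Qed.

End RealMatrices.

Section NormVector.
Context {R : realType} {n : nat}.
Variable a : 'I_n -> R.
Local Notation cdot := (@cdot R n).

Definition real_vector : 'cV[R[i]]_n := \col_i (a i)%:C.

Lemma re_cdot_mxop_real (A : 'M[R]_n) :
  complex.Re (cdot (mxop A real_vector) real_vector) = \sum_i \sum_j A i j * a j * a i.
Proof.
rewrite cdotE -[RHS]/(complex.Re ((\sum_i \sum_j A i j * a j * a i)%:C)).
congr complex.Re; rewrite rmorph_sum; apply: eq_bigr => i _.
rewrite mxopE mulr_suml rmorph_sum; apply: eq_bigr => j _.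
by rewrite !mxE conjc_real !rmorphM.
Qed.

Lemma hnorm_real_vector_sqr : hnorm cdot real_vector ^+ 2 = \sum_i a i ^+ 2.
Proof.
rewrite hnorm_sqr -[LHS]/(complex.Re (cdot real_vector real_vector)) cdotE.
rewrite -[RHS]/(complex.Re ((\sum_i a i ^+ 2)%:C)); congr complex.Re.
by rewrite rmorph_sum; apply: eq_bigr => i _; rewrite !mxE conjc_real rmorphXn expr2.
Qed.

End NormVector.

Lemma dsum_dot_le {R : realType} {H : lmodType R[i]} (d : {dot H for conjC}) n
  (T : 'I_n -> 'I_n -> H -> H) (x : {ffun 'I_n -> H}) :
  (forall i j, bounded_op d (T i j)) ->
  complex.Re `|@dsum_dot R H d n (opmx T x) x| <=
  \sum_i \sum_j Smx d T i j * hnorm d (x j) * hnorm d (x i).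
Proof.
move=> hT; rewrite /dsum_dot.
apply: (big_ind2 (fun (z : R[i]) (r : R) => complex.Re `|z| <= r)).
- by rewrite normr0.
- by move=> v r v' r' h h'; apply: le_trans (Re_normD _ _) _; exact: lerD.
- move=> i _; rewrite ffunE linear_sumlz.
  apply: (big_ind2 (fun (z : R[i]) (r : R) => complex.Re `|z| <= r)).
  + by rewrite normr0.
  + by move=> v r v' r' h h'; apply: le_trans (Re_normD _ _) _; exact: lerD.
  + move=> j _; apply: le_trans (dot_le_hnorm _ _ _) _.
    by rewrite mxE ler_wpM2r ?hnorm_ge0 ?hnorm_le_opnorm.
Qed.

(** The sandwich for an arbitrary matrix [B] majorizing the norms of the
    entries of [T]. *)
Lemma numradius_norm_majorant {R : realType} {H : lmodType R[i]}
  (d : {dot H for conjC}) (n : nat) (T : 'I_n -> 'I_n -> H -> H) (B : 'M[R]_n) :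
  (forall i j, bounded_op d (T i j)) ->
  (forall i j, opnorm d (T i j) <= B i j) ->
  exists m : R,
    is_min [set mixed_bound (2^-1 *: (B + B^T)) (Smx d T) a | a in `[0, 1]] m /\
    numradius (@dsum_dot R H d n) (opmx T) <= m /\
    m <= numradius (@cdot R n) (mxop B).
Proof.
move=> hT hB; have cC := @hcomplete_cdot R n.
set A := 2^-1 *: (B + B^T); set S := Smx d T.
have bA := bounded_mxop A; have bS := bounded_mxop S; have bB := bounded_mxop B.
have [c c01 hc] := mixed_squares_min (@cdot R n) cC (mxop A) (mxop S) bA bS.
exists (mixed_bound A S c); split; [split|split].
- by exists c => //=; rewrite in_itv.
- by move=> _ [a a01 <-]; apply: hc; rewrite /= in_itv in a01.
- apply: sup_le_ge0; last exact: sqrtr_ge0.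
  move=> _ [x x1 <-].
  have {}x1 : hnorm (@dsum_dot R H d n) x = 1 by exact: x1.
  pose u := real_vector (fun i => hnorm d (x i)).
  have u1 : hnorm (@cdot R n) u = 1.
    apply/eqP; rewrite -(@eqrXn2 _ 2%N) ?hnorm_ge0// hnorm_real_vector_sqr.
    by rewrite -hnorm_dsum_sqr x1.
  have le_u C : complex.Re (@cdot R n (mxop C u) u) <= hnorm (@cdot R n) (mxop C u).
    by rewrite -[leRHS]mulr1 -u1; exact: re_le_hnorm.
  set v := complex.Re `|_|.
  have v0 : 0 <= v by apply: le_trans (re_norm_ge _).
  have vsum : v <= \sum_i \sum_j S i j * hnorm d (x j) * hnorm d (x i).
    exact: dsum_dot_le.
  have vS : v <= hnorm (@cdot R n) (mxop S u).
    by apply: le_trans (le_u S); rewrite re_cdot_mxop_real.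
  have vA : v <= hnorm (@cdot R n) (mxop A u).
    apply: le_trans (le_u A); rewrite re_cdot_symmetric_part re_cdot_mxop_real.
    apply: le_trans vsum _; apply: ler_sum => i _; apply: ler_sum => j _.
    by rewrite !ler_wpM2r ?hnorm_ge0// mxE.
  exact: (le_mixed_squares (@cdot R n) cC _ _ bA bS _ _ _ c01 u1 v0 vA vS).
- apply: le_trans (hc 1 _) _; first by rewrite ler01 lexx.
  have w0 := numradius_ge0 (@cdot R n) _ bB.
  have hA := symmetric_norm_le (@cdot R n) (mxop A) _ bA.1
    (symmetric_mxop_symmetric_part B) (re_cdot_symmetric_part_le B) w0.
  exact: (mixed_squares1_le (@cdot R n) cC _ (mxop S) bA _ hA w0).
Qed.

Theorem corollary2p12 (R : realType) (H : completeNormedModType R[i])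
    (d : {dot H for conjC}) (hd : is_inner d)
    (n : nat) (T : 'I_n -> 'I_n -> H -> H)
    (hT : forall i j, bounded_op d (T i j))
    (f g : R -> R)
    (f_cont : {within `[0, +oo[, continuous f})
    (g_cont : {within `[0, +oo[, continuous g})
    (f_ge0 : forall t : R, 0 <= t -> 0 <= f t)
    (g_ge0 : forall t : R, 0 <= t -> 0 <= g t)
    (fg : forall t : R, 0 <= t -> f t * g t = t) :
  exists m : R,
    is_min [set mixed_bound (Rmx d f g T) (Smx d T) a | a in `[0, 1]] m /\
    numradius (@dsum_dot R H d n) (opmx T) <= m /\
    m <= numradius (@cdot R n) (mxop (Tmx d f g T)).
Proof.
have cH := hcomplete_inner _ _ hd.
have -> : Rmx d f g T = 2^-1 *: (Tmx d f g T + (Tmx d f g T)^T).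
  by apply/matrixP => i j; rewrite !mxE.
apply: numradius_norm_majorant => // i j.
by rewrite mxE; apply: opnorm_le_cfc_sq.
Qed.
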